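(* Let $a\in(-1,1)$ and let $H$ be the operator in $L^2((-\frac{\pi}{2},\frac{\pi}{2}))$ defined by $H\psi=-\psi''$ on the domain $\mathsf{D}(H)=\{\psi\in H^2((-\frac{\pi}{2},\frac{\pi}{2})) : \psi(-\frac{\pi}{2})=\psi(\frac{\pi}{2}a)=\psi(\frac{\pi}{2})\}$. Set $$\sigma_{\pm1}=\Big\{\Big(\frac{4m}{1\pm a}\Big)^2 : m\in\mathbb{N}^*\Big\},\qquad \sigma_0=\{(2m)^2 : m\in\mathbb{N}\}.$$ 1. If $a\notin\mathbb{Q}$, then all the eigenvalues of $H$ are algebraically simple. 2. Let $a\in\mathbb{Q}$. Each point of $\sigma(H)\setminus(\sigma_{-1}\cap\sigma_{+1})$ is an eigenvalue of $H$ of algebraic multiplicity one. Each point of $\sigma_{-1}\cap\sigma_{+1}=\sigma_{-1}\cap\sigma_{+1}\cap\sigma_0$ is an eigenvalue of $H$ of geometric multiplicity two and algebraic multiplicity three.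
   Context: $\mathbb{N}=\{0,1,2,\dots\}$ and $\mathbb{N}^*=\mathbb{N}\setminus\{0\}$. $L^2((-\frac{\pi}{2},\frac{\pi}{2}))$ is the complex Hilbert space of square-integrable functions and $H^2$ denotes the usual Sobolev space, whose elements are identified with their continuous representatives on $[-\frac{\pi}{2},\frac{\pi}{2}]$. $\sigma(H)$ is the spectrum of $H$. The geometric multiplicity of an eigenvalue $\lambda$ is $\dim\ker(H-\lambda)$ and its algebraic multiplicity is $\dim\bigcup_{n\ge1}\ker(H-\lambda)^n$; algebraically simple means algebraic multiplicity one. *)

(* Defs.v *)
From HB Require Import structures.
From mathcomp Require Import all_boot all_order all_algebra.
From mathcomp Require Import complex.
From mathcomp Require Import all_classical all_reals all_analysis.

Set Implicit Arguments.
Unset Strict Implicit.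
Unset Printing Implicit Defensive.

Import Order.TTheory GRing.Theory Num.Theory.
Import numFieldNormedType.Exports.

Local Open Scope classical_set_scope.
Local Open Scope ring_scope.
Local Open Scope complex_scope.

(* Elements of L^2(mu; C) are represented by functions T -> R[i] modulo equality
   mu-almost everywhere. *)
Section ComplexL2.
Context {d : measure_display} {T : measurableType d} {R : realType}.
Variable mu : {measure set T -> \bar R}.
Implicit Types f g : T -> R[i].

Definition cL2 f : Prop :=
  ((fun x => complex.Re (f x)) \in Lfun mu 2%:E) /\ ((fun x => complex.Im (f x)) \in Lfun mu 2%:E).

Definition cL2norm f : \bar R := Lnorm mu 2%:E (fun x => (Normc.normc (f x))%:E).

Definition cintegral f : R[i] :=
  (\int[mu]_x complex.Re (f x)) +i* (\int[mu]_x complex.Im (f x)).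

(* [has_dim V n]: the linear subspace V of L^2(mu; C) has dimension n. *)
Definition has_dim (V : set (T -> R[i])) (n : nat) : Prop :=
  exists e : 'I_n -> T -> R[i],
    [/\ forall i, V (e i),
        forall c : 'I_n -> R[i],
          ae_eq mu setT (fun x => \sum_(i < n) c i * e i x) (fun=> 0) ->
          forall i, c i = 0
      & forall f, V f -> exists c : 'I_n -> R[i],
          ae_eq mu setT f (fun x => \sum_(i < n) c i * e i x)].

(* An unbounded operator in L^2(mu; C) is given by its graph, a relation between
   representatives: [A f g] means that f is in the domain of A and A f = g. *)
Variable A : (T -> R[i]) -> (T -> R[i]) -> Prop.

(* ker (A - lam)^n, where f is in the domain of (A - lam)^(n+1) iff it is in the
   domain of A and (A - lam) f is in the domain of (A - lam)^n. *)
Fixpoint ker_pow (lam : R[i]) (n : nat) (f : T -> R[i]) : Prop :=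
  match n with
  | 0 => cL2 f /\ ae_eq mu setT f (fun=> 0)
  | m.+1 => exists2 g, A f g & ker_pow lam m (fun x => g x - lam * f x)
  end.

Definition op_eigenvalue (lam : R[i]) : Prop :=
  exists2 f, ker_pow lam 1 f & ~ ae_eq mu setT f (fun=> 0).

Definition geometric_multiplicity (lam : R[i]) (n : nat) : Prop :=
  has_dim [set f | ker_pow lam 1 f] n.

Definition algebraic_multiplicity (lam : R[i]) (n : nat) : Prop :=
  has_dim [set f | exists2 k, (1 <= k)%N & ker_pow lam k f] n.

(* A - lam is a bijection from the domain of A onto L^2(mu; C), with a bounded
   inverse. *)
Definition resolvent_set : set R[i] := [set lam |
  [/\ forall f, ker_pow lam 1 f -> ae_eq mu setT f (fun=> 0),
      forall h, cL2 h -> exists f g, A f g /\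
        ae_eq mu setT (fun x => g x - lam * f x) h
    & exists K : R, forall f g, A f g ->
        (cL2norm f <= K%:E * cL2norm (fun x => (g x - lam * f x)%R))%E]].

Definition spectrum : set R[i] := ~` resolvent_set.

End ComplexL2.

Section Operator.
Context {R : realType}.
Implicit Types (a : R) (u v f g : R -> R[i]).

Definition I_open : set R := `](- (pi / 2)), (pi / 2)[.

Lemma measurable_I_open : measurable (I_open : set (measurableTypeR R)).
Proof. exact: measurable_itv. Qed.

Definition muI : {measure set (measurableTypeR R) -> \bar R} :=
  mrestr lebesgue_measure measurable_I_open.

(* C_c^oo of the open interval, extended by zero to R. Real-valued test functions
   suffice for the weak derivatives of complex functions, by linearity. *)
Definition test_function (phi : R -> R) : Prop :=
  (forall n x, derivable (derive1n n phi) x 1) /\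
  exists c e, [/\ - (pi / 2) < c, e < pi / 2 &
    forall x, x \notin `[c, e] -> phi x = 0].

Definition weak_derivative (n : nat) u v : Prop :=
  forall phi, test_function phi ->
    cintegral muI (fun x => u x * (derive1n n phi x)%:C) =
    (-1) ^+ n * cintegral muI (fun x => v x * (phi x)%:C).

(* An element of H^2 has its weak derivatives of order 1 and 2 in L^2. *)
Definition sobolevH2 u : Prop :=
  cL2 muI u /\
  forall n, (1 <= n <= 2)%N -> exists2 v, cL2 muI v & weak_derivative n u v.

Definition continuous_on_closure u : Prop :=
  {within `[(- (pi / 2)), (pi / 2)], continuous (fun x => complex.Re (u x))} /\
  {within `[(- (pi / 2)), (pi / 2)], continuous (fun x => complex.Im (u x))}.

Definition domH a u : Prop :=
  [/\ sobolevH2 u, continuous_on_closure u,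
      u (- (pi / 2)) = u (pi / 2 * a) & u (pi / 2 * a) = u (pi / 2)].

(* Graph of H: g = - u'' for the continuous representative u of f. The boundary
   conditions bear on u, since f is only defined up to a null set. *)
Definition opH a f g : Prop :=
  [/\ cL2 muI f, cL2 muI g &
    exists u, [/\ domH a u, ae_eq muI setT f u &
      weak_derivative 2 u (fun x => - g x)]].

(* Used with s = 1 and s = -1. *)
Definition sigma_pm (s a : R) : set R[i] :=
  [set lam | exists2 m : nat, (0 < m)%N &
    lam = ((4 * m%:R / (1 + s * a)) ^+ 2)%:C].

Definition sigma0 : set R[i] :=
  [set lam | exists m : nat, lam = ((2 * m%:R : R) ^+ 2)%:C].

End Operator.

(* Main.v *)
Require Import Defs.
From HB Require Import structures.
From mathcomp Require Import all_boot all_order all_algebra.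
From mathcomp Require Import complex ring lra.
From mathcomp Require Import all_classical all_reals all_analysis.
From mathcomp Require Import measurable_realfun.

Set Implicit Arguments.
Unset Strict Implicit.
Unset Printing Implicit Defensive.

Import Order.TTheory GRing.Theory Num.Theory.
Import numFieldNormedType.Exports.

Local Open Scope classical_set_scope.
Local Open Scope ring_scope.
Local Open Scope complex_scope.

(* Since a continuous function whose weak second derivative vanishes is affine,
   the graph of the operator consists of absolutely continuous pairs
   u' = v, v' = - g satisfying the boundary conditions, so that eigenfunctions are
   combinations of c = cos (k x) and s = sin (k x) / k with k ^ 2 = lam.
   Put L = pi / 2 and p = a L. The boundary conditions have a nontrivial solution
   iff s(L) (c(L) - c(p)) = 0, and c(L) - c(p) = - 2 lam s((L + p) / 2) s((L - p) / 2)
   while s(L) is given by the addition formula at the same half angles; hence for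
   lam <> 0 either exactly one of s(L), s((L + p) / 2), s((L - p) / 2) vanishes or
   all of them do, and the last case is the intersection of the two families.
   Solving the resonant equations - phi'' - lam phi = psi shows that
   the boundary conditions kill the secular terms in the first case, and leave
   exactly one generalized eigenfunction, x s(x), in the second. When the
   determinant does not vanish, variation of constants gives a bounded inverse. *)

Section AbsolutelyContinuous.
Context {R : realType}.
Implicit Types (a b c x : R) (F G f g : R -> R).
Local Notation leb := (@lebesgue_measure R).

Definition itg a b f : Prop := leb.-integrable `[a, b] (EFin \o f).

Definition prim a f x : R := \int[leb]_(t in `[a, x]) f t.

Definition AC a b F f : Prop :=
  itg a b f /\ forall x, x \in `[a, b] -> F x = F a + prim a f x.

Lemma itg_sub a b f x : itg a b f -> x \in `[a, b] -> itg a x f.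
Proof.
move=> fi xab; apply: integrableS fi => //.
by apply: subset_itvl; rewrite bnd_simp (itvP xab).
Qed.

Lemma prim0 a f : prim a f a = 0.
Proof. by rewrite /prim set_itv1 Rintegral_set1. Qed.

Lemma itg_mem_measurable a b f : itg a b f -> measurable_fun `[a, b] f.
Proof. by case/integrableP => /measurable_EFinP. Qed.

Lemma itgD a b f g : itg a b f -> itg a b g -> itg a b (fun x => f x + g x).
Proof. by move=> fi gi; apply: eq_integrable (integrableD _ fi gi). Qed.

Lemma itgZ a b k f : itg a b f -> itg a b (fun x => k * f x).
Proof. by move=> fi; apply: eq_integrable (integrableZl _ k fi). Qed.

Lemma primD a b f g x : itg a b f -> itg a b g -> x \in `[a, b] ->
  prim a (fun x => f x + g x) x = prim a f x + prim a g x.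
Proof. by move=> fi gi xab; rewrite /prim RintegralD//; exact: itg_sub xab. Qed.

Lemma primZ a b k f x : itg a b f -> x \in `[a, b] ->
  prim a (fun x => k * f x) x = k * prim a f x.
Proof. by move=> fi xab; rewrite /prim RintegralZl//; exact: itg_sub xab. Qed.

Lemma itg_cst a b k : itg a b (fun=> k).
Proof.
apply: continuous_compact_integrable; first exact: segment_compact.
by move=> x; exact: cvg_cst.
Qed.

Lemma AC_prim a b f : itg a b f -> AC a b (prim a f) f.
Proof. by move=> fi; split=> // x xab; rewrite prim0 add0r. Qed.

Lemma AC_cst a b k : AC a b (fun=> k) (fun=> 0).
Proof.
split=> [|x xab]; first exact: itg_cst.
by rewrite /prim Rintegral_cst// mul0r addr0.
Qed.

Lemma ACD a b F G f g : AC a b F f -> AC a b G g ->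
  AC a b (fun x => F x + G x) (fun x => f x + g x).
Proof.
move=> [fi Ff] [gi Gg]; split=> [|x xab]; first exact: itgD.
by rewrite (primD fi gi xab) Ff// Gg// addrACA.
Qed.

Lemma ACZ a b k F f : AC a b F f -> AC a b (fun x => k * F x) (fun x => k * f x).
Proof.
move=> [fi Ff]; split=> [|x xab]; first exact: itgZ.
by rewrite (primZ k fi xab) Ff// mulrDr.
Qed.

Lemma AC_eq a b F G f : AC a b F f -> {in `[a, b], F =1 G} -> AC a b G f.
Proof.
move=> [fi Ff] FG; split=> // x xab; rewrite -(FG x)// -(FG a) ?(Ff x)//.
move: xab; rewrite !in_itv/= lexx => /andP[/le_trans]; exact.
Qed.

Lemma AC_ae a b F f g : AC a b F f -> measurable_fun `[a, b] g ->
  ae_eq leb [set` `[a, b]] f g -> AC a b F g.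
Proof.
move=> [fi Ff] mg fg; have mf := itg_mem_measurable fi; split=> [|x xab].
  case/integrableP: (fi) => _ fi'; apply/integrableP; split.
    exact/measurable_EFinP.
  apply: le_lt_trans fi'; rewrite le_eqVlt; apply/orP; left; apply/eqP.
  apply: ae_eq_integral => //.
  - by do 2 apply: measurableT_comp => //.
  - by do 2 apply: measurableT_comp => //.
  - by apply: filterS fg => y /[apply] /= ->.
rewrite Ff//; congr (_ + fine _); have sub : `[a, x] `<=` `[a, b].
  by apply: subset_itvl; rewrite bnd_simp (itvP xab).
apply: ae_eq_integral => //.
- by apply/measurable_EFinP; exact: measurable_funS mf.
- by apply/measurable_EFinP; exact: measurable_funS mg.
- by apply: filterS fg => y /= fgy ayx; rewrite fgy//; exact: sub.
Qed.

Lemma AC_eq_deriv a b F f g : AC a b F f -> {in `[a, b], f =1 g} -> AC a b F g.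
Proof.
move=> Ff fg; apply: (AC_ae Ff); last by apply/aeW => x xab; rewrite fg// inE.
apply: eq_measurable_fun (itg_mem_measurable Ff.1) => x.
by rewrite inE => xab; rewrite fg// inE.
Qed.

Lemma AC0_cst a b F x : AC a b F (fun=> 0) -> x \in `[a, b] -> F x = F a.
Proof.
by move=> [_ F0] xab; rewrite F0// /prim Rintegral_cst// mul0r addr0.
Qed.

Lemma AC_continuous a b F f : a <= b -> AC a b F f ->
  {within `[a, b], continuous F}.
Proof.
move=> ab [fi Ff].
apply: (@subspace_eq_continuous _ _ _ (fun x => F a + prim a f x)).
  by move=> x; rewrite inE /= => xab; rewrite -Ff.
have := parameterized_integral_continuous ab fi.
move=> /subspace_continuousP pc; apply/subspace_continuousP => x xab.
by apply: cvgD; [exact: cvg_cst|exact: pc].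
Qed.

Lemma within_continuous_itg a b F : {within `[a, b], continuous F} -> itg a b F.
Proof.
by move=> Fc; apply: continuous_compact_integrable => //; exact: segment_compact.
Qed.

Lemma within_continuous_bounded a b F : {within `[a, b], continuous F} ->
  [bounded F x | x in `[a, b]].
Proof.
move=> Fc; have := continuous_compact Fc (@segment_compact _ a b).
move=> /compact_bounded [M [Mr MF]]; exists M; split=> // y My.
by move=> x xab; apply: (MF y My); exists x.
Qed.

Lemma within_continuous_measurable a b F : {within `[a, b], continuous F} ->
  measurable_fun `[a, b] F.
Proof. by move=> Fc; apply: subspace_continuous_measurable_fun. Qed.

Lemma itgM_continuous a b F g : {within `[a, b], continuous F} -> itg a b g ->
  itg a b (fun x => F x * g x).
Proof.
move=> Fc gi.
have mI : measurable ([set` `[a, b]] : set (measurableTypeR R)) by exact: measurable_itv.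
have := integrableMr mI (within_continuous_measurable Fc)
  (within_continuous_bounded Fc) gi.
by apply: eq_integrable.
Qed.

Lemma patch_itvE a b f t :
  (f \_ `[a, b]) t = if (a <= t) && (t <= b) then f t else 0.
Proof.
rewrite patchE; case: ifPn => [|nt]; first by rewrite inE /= in_itv/= => ->.
by case: ifPn => // tab; case/negP: nt; apply/mem_set; rewrite /= in_itv.
Qed.

Lemma itg_restrict a b f : itg a b f ->
  leb.-integrable setT (EFin \o (f \_ `[a, b])).
Proof.
by move=> fi; rewrite -restrict_EFin; apply/integrable_restrict => //; rewrite setTI.
Qed.

(* Fubini on the triangle [a <= t <= s <= b]. *)
Lemma prim_triangle a b f g : a <= b -> itg a b f -> itg a b g ->
  prim a (fun s => f s * prim a g s) b =
  prim a (fun t => g t * (prim a f b - prim a f t)) b.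
Proof.
move=> ab fi gi.
pose T := measurableTypeR R.
pose fr := f \_ `[a, b]; pose gr := g \_ `[a, b].
pose h (z : T * T) : R := fr z.1 * gr z.2 * (if z.2 <= z.1 then 1 else 0).
have mI : measurable ([set` `[a, b]] : set R) by exact: measurable_itv.
have mfr : measurable_fun (setT : set T) fr.
  exact: (measurable_restrictT f mI).1 (itg_mem_measurable fi).
have mgr : measurable_fun (setT : set T) gr.
  exact: (measurable_restrictT g mI).1 (itg_mem_measurable gi).
have mh : measurable_fun setT h.
  apply: measurable_funM; first apply: measurable_funM.
  - exact: (measurableT_comp mfr).
  - exact: (measurableT_comp mgr).
  apply: measurable_fun_ifT => //.
  by apply: measurable_fun_ler; [exact: measurable_snd|exact: measurable_fst].
have normh s t : `|h (s, t)| <= `|fr s| * `|gr t|.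
  by rewrite /h /= !normrM; case: ifP => _; rewrite ?normr1 ?mulr1// normr0 mulr0 mulr_ge0.
have ifr := itg_restrict fi; have igr := itg_restrict gi.
have hint : (leb \x leb)%E.-integrable setT (EFin \o h).
  apply/integrable12ltyP; first exact/measurable_EFinP.
  apply: (@le_lt_trans _ _ (\int[leb]_s (`|fr s|%:E * \int[leb]_t `|gr t|%:E))%E).
    apply: ge0_le_integral => //.
    - by move=> s _; apply: integral_ge0.
    - apply: (measurable_fun_fubini_tonelli_F (m2 := leb) (abse \o (EFin \o h))) => //.
        by apply: measurableT_comp => //; exact/measurable_EFinP.
      by move=> x; exact: abse_ge0.
    - apply: emeasurable_funM => //; do 2 apply: measurableT_comp => //.
    - move=> s _; rewrite -ge0_integralZl//; last first.
        by do 2 apply: measurableT_comp => //.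
      apply: ge0_le_integral => //.
      + apply: measurableT_comp => //; apply/measurable_EFinP.
        exact: (measurableT_comp mh
          (measurable_fun_pair (measurable_cst s) (@measurable_id _ T setT))).
      + apply: measurable_funeM. by do 2 apply: measurableT_comp => //.
      + by move=> t _ /=; rewrite -EFinM lee_fin.
  case/integrableP: ifr => _ ifr; case/integrableP: igr => _ igr.
  rewrite ge0_integralZr//; last first.
  - exact: integral_ge0.
  - by do 2 apply: measurableT_comp => //.
  apply: lte_mul_pinfty => //; first exact: integral_ge0.
  by rewrite ge0_fin_numE//; exact: integral_ge0.
have fin_int f' A : measurable A -> leb.-integrable A (EFin \o f') ->
    (\int[leb]_(t in A) (f' t)%:E = (\int[leb]_(t in A) f' t)%:E)%E.
  by move=> mA ?; rewrite /Rintegral fineK//; exact: integrable_fin_num.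
have in1 s : (\int[leb]_t (h (s, t))%:E = (fr s * prim a g s)%:E)%E.
  rewrite /h /= /fr patch_itvE.
  case: ifPn => [/andP[as_ sb]|_]; last first.
    rewrite mul0r integral0_eq// => t _; by rewrite !mul0r.
  transitivity (\int[leb]_t (f s * (g \_ `[a, s]) t)%:E)%E.
    apply: eq_integral => t _; rewrite -mulrA; congr (_ * _)%:E.
    rewrite /gr !patch_itvE; have [ts|ts] := leP t s; last by rewrite andbF mulr0.
    by rewrite (le_trans ts sb) mulr1.
  have ig : leb.-integrable setT (EFin \o (g \_ `[a, s])).
    by apply/itg_restrict/(itg_sub gi); rewrite in_itv/= as_.
  rewrite (fin_int (fun t => f s * (g \_ `[a, s]) t))//.
    by rewrite RintegralZl// -Rintegral_mkcond.
  by have := integrableZl measurableT (f s) ig; apply: eq_integrable.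
have in2 t : (\int[leb]_s (h (s, t))%:E = (gr t * (prim a f b - prim a f t))%:E)%E.
  rewrite /h /= /gr patch_itvE.
  case: ifPn => [/andP[at_ tb]|_]; last first.
    by rewrite mul0r integral0_eq// => s _; rewrite mulr0 mul0r.
  transitivity (\int[leb]_s (g t * (f \_ `[t, b]) s)%:E)%E.
    apply: eq_integral => s _; rewrite mulrAC mulrC; congr (_ * _)%:E.
    rewrite /fr !patch_itvE; have [ts|ts] := leP t s; last by rewrite mulr0.
    by rewrite (le_trans at_ ts) mulr1.
  have fi' : itg t b f.
    by apply: integrableS fi => //; apply: subset_itvr; rewrite bnd_simp.
  have ig := itg_restrict fi'.
  rewrite (fin_int (fun s => g t * (f \_ `[t, b]) s))//; last first.
    by have := integrableZl measurableT (g t) ig; apply: eq_integrable.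
  rewrite RintegralZl// -Rintegral_mkcond /prim Rintegral_itvB ?bnd_simp//.
  rewrite Rintegral_itv_obnd_cbnd//.
  by apply: integrableS fi' => //; exact: subset_itv_oc_cc.
have := Fubini hint; rewrite /=.
under eq_integral do rewrite in1.
under [RHS]eq_integral do rewrite in2.
move=> /(congr1 fine) H.
rewrite [LHS]Rintegral_mkcond [RHS]Rintegral_mkcond.
move: H; congr (_ = _); congr fine; apply: eq_integral => t _; congr _%:E.
- by rewrite /fr !patch_itvE; case: ifP => //; rewrite mul0r.
- by rewrite /gr !patch_itvE; case: ifP => //; rewrite mul0r.
Qed.

Lemma AC_prim_mul a b f g : a <= b -> itg a b f -> itg a b g ->
  AC a b (fun x => prim a f x * prim a g x)
    (fun x => f x * prim a g x + prim a f x * g x).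
Proof.
move=> ab fi gi.
have Pc := parameterized_integral_continuous ab fi.
have Qc := parameterized_integral_continuous ab gi.
have fQ : itg a b (fun x => f x * prim a g x).
  by apply: eq_integrable (itgM_continuous Qc fi) => // x _; rewrite /= mulrC.
have Pg : itg a b (fun x => prim a f x * g x) by exact: itgM_continuous Pc gi.
split=> [|x xab]; first exact: itgD.
rewrite !prim0 mul0r add0r (primD fQ Pg xab).
have ax : a <= x by rewrite (itvP xab).
rewrite (prim_triangle ax (itg_sub fi xab) (itg_sub gi xab)).
rewrite -(primD _ Pg xab); last first.
  have := itgD (itgZ (prim a f x) gi) (itgZ (-1) Pg).
  by apply: eq_integrable => // t _ /=; congr EFin; ring.
rewrite -(primZ _ gi xab); apply: eq_Rintegral => t _; ring.
Qed.

Lemma ACM a b F G f g : a <= b -> AC a b F f -> AC a b G g ->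
  AC a b (fun x => F x * G x) (fun x => f x * G x + F x * g x).
Proof.
move=> ab [fi Ff] [gi Gg].
have H := ACD (AC_cst a b (F a * G a)) (ACD (ACZ (F a) (AC_prim gi))
  (ACD (ACZ (G a) (AC_prim fi)) (AC_prim_mul ab fi gi))).
apply: AC_eq_deriv (AC_eq H _) _ => x xab /=; rewrite (Ff x)// (Gg x)//; ring.
Qed.

Lemma AC_C1 a b F f : a <= b -> (forall x, is_derive x 1 F (f x)) ->
  continuous f -> AC a b F f.
Proof.
move=> ab Ff fc.
have Fc : continuous F.
  by move=> x; apply/differentiable_continuous/derivable1_diffP; have [] := Ff x.
split=> [|x xab]; first by apply: within_continuous_itg; exact: continuous_subspaceT.
have [->|ax] := eqVneq x a.
  by rewrite prim0 addr0.
have {}ax : a < x by rewrite lt_neqAle eq_sym ax (itvP xab).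
have := @continuous_FTC2 _ f F a x ax (continuous_subspaceT fc).
rewrite /prim /Rintegral => ->; first by rewrite /= subrKC.
  split; first by move=> z _; have [] := Ff z.
  - exact/cvg_at_right_filter/Fc.
  - exact/cvg_at_left_filter/Fc.
by move=> z _; rewrite derive1E; have [] := Ff z.
Qed.

End AbsolutelyContinuous.

Section SmoothFunctions.
Context {R : realType}.
Implicit Types (F G f g : R -> R) (x y c d : R).

Lemma is_derive_add f g x df dg : is_derive x 1 f df -> is_derive x 1 g dg ->
  is_derive x 1 (fun y => f y + g y) (df + dg).
Proof. exact: is_deriveD. Qed.

Lemma is_derive_mul f g x df dg : is_derive x 1 f df -> is_derive x 1 g dg ->
  is_derive x 1 (fun y => f y * g y) (df * g x + f x * dg).
Proof.
move=> Df Dg; apply: is_derive_eq (is_deriveM Df Dg) _.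
by rewrite /GRing.scale/= addrC mulrC.
Qed.

Lemma is_derive_affine c d x : is_derive x 1 (fun y => c * y + d) c.
Proof.
have := is_derive_add (is_derive_mul (is_derive_cst c x 1) (is_derive_id x 1))
  (is_derive_cst d x 1).
by move/is_derive_eq; apply; rewrite mul0r mulr1 add0r addr0.
Qed.

Lemma is_derive_continuous f df x : is_derive x 1 f df -> {for x, continuous f}.
Proof.
by case=> Df _; apply/differentiable_continuous/derivable1_diffP.
Qed.

Definition flat (n : nat) y : R :=
  if 0 < y then y^-1 ^+ n * expR (- y^-1) else 0.

Lemma flat_le0 n y : y <= 0 -> flat n y = 0.
Proof. by rewrite /flat ltNge => ->. Qed.

Lemma flat_ge0 n y : 0 <= flat n y.
Proof.
rewrite /flat; case: ifP => // y0.
by rewrite mulr_ge0 ?expR_ge0// exprn_ge0// invr_ge0 ltW.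
Qed.

Lemma flat_sqr_bound n y : flat n y <= (n.+2)`!%:R * y ^+ 2.
Proof.
rewrite /flat; case: ifPn => [y0|_]; last by rewrite mulr_ge0 ?sqr_ge0.
have t0 : 0 <= y^-1 by rewrite invr_ge0 ltW.
have := expR_ge1Dxn n.+1 t0; set t := y^-1 => le_e.
have f0 : 0 < (n.+2)`!%:R :> R by rewrite ltr0n fact_gt0.
rewrite expRN ler_pdivrMr ?expR_gt0//.
have {le_e} : t ^+ n.+2 / (n.+2)`!%:R <= expR t.
  by apply: le_trans le_e; rewrite lerDr.
rewrite ler_pdivrMr// => le_e.
rewrite mulrAC -ler_pdivrMr ?exprn_gt0// -exprVn.
by rewrite -exprD addn2 mulrC.
Qed.

Lemma is_derive_flat n x :
  is_derive x 1 (flat n) (- n%:R * flat n.+1 x + flat n.+2 x).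
Proof.
have [x0|x0|->] := ltgtP x 0.
- rewrite !flat_le0 ?(ltW x0)// mulr0 addr0.
  apply: (@near_eq_is_derive _ _ _ (fun=> 0)).
    near=> y; rewrite flat_le0//; apply: ltW; near: y.
    exact: lt_nbhsl.
- apply: (@near_eq_is_derive _ _ _ (fun y => y^-1 ^+ n * expR (- y^-1))).
    near=> y; rewrite /flat ifT//; near: y; exact: lt_nbhsr.
  rewrite /flat x0.
  have Dinv : is_derive x 1 (fun y => y^-1) (- x^-1 ^+ 2).
    have := @is_deriveV R id x 1 1 (lt0r_neq0 x0) (is_derive_id x 1).
    by move/is_derive_eq; apply; rewrite /GRing.scale/= mulr1 exprVn.
  have De : is_derive x 1 (fun y => expR (- y^-1)) (expR (- x^-1) * x^-1 ^+ 2).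
    have := @is_derive1_comp R expR (fun y => - y^-1) x _ _
      (is_derive_expR (- x^-1)) (is_deriveN Dinv).
    by rewrite opprK.
  have Dp : is_derive x 1 (fun y => y^-1 ^+ n)
      (- n%:R * x^-1 ^+ n.+1).
    have := is_deriveX n Dinv; rewrite exprfctE; move/is_derive_eq; apply.
    rewrite /GRing.scale/=; case: n => [|n] /=; first by rewrite oppr0 !mul0r.
    by rewrite mulrN -mulrA -exprD addn2 mulNr.
  apply: is_derive_eq (is_derive_mul Dp De) _.
  by rewrite !exprS; ring.
- rewrite !flat_le0// mulr0 addr0.
  suff H : h^-1 *: (flat n (h *: 1 + 0) - flat n 0) @[h --> 0^'] --> (0 : R).
    by apply: DeriveDef; [exact: cvgP H|exact: cvg_lim H].
  pose C : R := (n.+2)`!%:R.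
  have C0 : 0 < C by rewrite ltr0n fact_gt0.
  apply/cvgrPdist_le => e e0; near=> h.
  have h0 : h != 0 by near: h; exact: nbhs_dnbhs_neq.
  rewrite sub0r normrN (@flat_le0 n 0)// subr0 /GRing.scale/= mulr1 addr0 normrM normfV.
  rewrite ler_pdivrMl ?normr_gt0// ger0_norm ?flat_ge0//.
  apply: le_trans (flat_sqr_bound n h) _.
  rewrite -/C -real_normK ?num_real// expr2 mulrCA ler_wpM2l//.
  rewrite -ler_pdivlMl//; near: h.
  by apply: dnbhs0_le; rewrite mulr_gt0 ?invr_gt0.
Unshelve. all: by end_near. Qed.

Inductive smooth : (R -> R) -> Prop :=
| smooth_flat n : smooth (flat n)
| smooth_cst c : smooth (fun=> c)
| smooth_add f g : smooth f -> smooth g -> smooth (fun x => f x + g x)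
| smooth_mul f g : smooth f -> smooth g -> smooth (fun x => f x * g x)
| smooth_affine f c d : smooth f -> smooth (fun x => f (c * x + d))
| smooth_antiderivative F f :
    (forall x, is_derive x 1 F (f x)) -> smooth f -> smooth F.

Lemma smooth_derive f : smooth f ->
  exists2 g, smooth g & forall x, is_derive x 1 f (g x).
Proof.
elim => {f} [n|c|f1 f2 s1 [g1 t1 D1] s2 [g2 t2 D2]
  |f1 f2 s1 [g1 t1 D1] s2 [g2 t2 D2]|f c d s [g t D]|F f D s _].
- exists (fun x => - n%:R * flat n.+1 x + flat n.+2 x); last first.
    exact: is_derive_flat.
  by apply: smooth_add; first (apply: smooth_mul; first exact: smooth_cst);
    exact: smooth_flat.
- exists (fun=> 0) => [|x]; [exact: smooth_cst|exact: is_derive_cst].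
- exists (fun x => g1 x + g2 x) => [|x]; first exact: smooth_add.
  exact: is_derive_add.
- exists (fun x => g1 x * f2 x + f1 x * g2 x) => [|x].
    by apply: smooth_add; exact: smooth_mul.
  exact: is_derive_mul.
- exists (fun x => g (c * x + d) * c) => [|x].
    by apply: smooth_mul; [exact: smooth_affine|exact: smooth_cst].
  exact: is_derive1_comp (D _) (is_derive_affine c d x).
- by exists f.
Qed.

Lemma is_derive_derive1E F f : (forall x, is_derive x 1 F (f x)) -> derive1 F = f.
Proof. by move=> D; apply/funext => x; rewrite derive1E; have [] := D x. Qed.

Lemma smooth_derivable1n f n x : smooth f -> derivable (derive1n n f) x 1.
Proof.
elim: n f => [|n IH] f sf; have [g sg D] := smooth_derive sf.
  by rewrite derive1n0; have [] := D x.
by rewrite derive1Sn (is_derive_derive1E D); exact: IH.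
Qed.

Lemma smooth_continuous f : smooth f -> continuous f.
Proof.
by move=> /smooth_derive[g _ D] x; exact: is_derive_continuous (D x).
Qed.

Lemma prim_le0 f x : (forall y, y <= 0 -> f y = 0) -> x <= 0 ->
  prim (-1) f x = 0.
Proof.
move=> f0 x0; rewrite /prim (@eq_Rintegral _ _ _ _ _ (fun=> 0)).
  by rewrite Rintegral_cst// mul0r.
by move=> y; rewrite inE/= in_itv/= => /andP[_ yx]; rewrite f0// (le_trans yx).
Qed.

Lemma is_derive_prim f x : continuous f -> (forall y, y <= 0 -> f y = 0) ->
  is_derive x 1 (prim (-1) f) (f x).
Proof.
move=> fc f0; have [x0|x0] := ltP x 0.
  rewrite f0 ?ltW//; apply: (@near_eq_is_derive _ _ _ (fun=> 0)).
  near=> y; rewrite prim_le0//; apply: ltW; near: y.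
  exact: lt_nbhsl.
have fi : itg (-1) (x + 1) f.
  by apply: within_continuous_itg; exact: continuous_subspaceT.
have x1 : -1 < x by rewrite (lt_le_trans _ x0)// ltrN10.
have xx : x < x + 1 by rewrite ltrDl.
have [] := continuous_FTC1_closed xx fi x1 (fc x).
by rewrite derive1E => D E; apply: DeriveDef.
Unshelve. all: by end_near. Qed.

Lemma smooth_prim f : smooth f -> (forall y, y <= 0 -> f y = 0) ->
  smooth (prim (-1) f).
Proof.
move=> sf f0; apply: smooth_antiderivative (sf) => x.
by apply: is_derive_prim => //; exact: smooth_continuous.
Qed.

Lemma exists_smooth_ramp d : 0 < d ->
  exists K K1 rho : R -> R, exists m c : R,
  [/\ smooth K, (forall x, is_derive x 1 K (K1 x)),
      smooth rho /\ (forall x, is_derive x 1 K1 (rho x)),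
      [/\ forall x, 0 <= rho x, forall x, x \notin `[0, d] -> rho x = 0,
          forall x, x <= 0 -> K x = 0 & forall x, x <= 0 -> K1 x = 0] &
      [/\ 0 < m, forall x, d <= x -> K1 x = m &
          forall x, d <= x -> K x = m * x + c]].
Proof.
move=> d0.
pose rho x := flat 0 x * flat 0 (-1 * x + d).
have srho : smooth rho.
  by apply: smooth_mul; [|apply: smooth_affine]; exact: smooth_flat.
have rho0 x : x <= 0 -> rho x = 0 by move=> x0; rewrite /rho flat_le0// mul0r.
have rhod x : d <= x -> rho x = 0.
  by move=> dx; rewrite /rho [X in _ * X]flat_le0 ?mulr0//; lra.
pose K1 := prim (-1) rho; pose K := prim (-1) K1.
have K10 x : x <= 0 -> K1 x = 0 by exact: prim_le0.
have sK1 : smooth K1 by exact: smooth_prim.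
have DK1 x : is_derive x 1 K1 (rho x).
  by apply: is_derive_prim => //; exact: smooth_continuous.
have DK x : is_derive x 1 K (K1 x).
  by apply: is_derive_prim => //; exact: smooth_continuous.
have sK : smooth K by exact: smooth_prim.
have K1d x : d <= x -> K1 x = K1 d.
  rewrite le_eqVlt => /predU1P[->//|dx].
  have [|y yd] := @MVT _ K1 rho d x dx (fun y _ => DK1 y).
    exact/continuous_subspaceT/smooth_continuous.
  rewrite rhod ?mul0r; first by move/eqP; rewrite subr_eq0 => /eqP.
  by rewrite ltW// (itvP yd).
have Kd x : d <= x -> K x = K1 d * x + (K d - K1 d * d).
  rewrite le_eqVlt => /predU1P[<-|dx]; first by rewrite subrKC.
  have [|y yd] := @MVT _ K K1 d x dx (fun y _ => DK y).
    exact/continuous_subspaceT/smooth_continuous.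
  rewrite K1d ?(itvP yd)//.
  by move=> E; lra.
have m0 : 0 < K1 d.
  have [|y yd] := @MVT _ K1 rho 0 d d0 (fun y _ => DK1 y).
    exact/continuous_subspaceT/smooth_continuous.
  rewrite (K10 0)// !subr0 => ->; rewrite mulr_gt0//.
  move: yd; rewrite in_itv/= => /andP[y0 yd].
  have yd' : 0 < -1 * y + d by lra.
  rewrite /rho /flat y0 yd'.
  by rewrite !expr0 !mul1r mulr_gt0 ?expR_gt0.
exists K, K1, rho, (K1 d), (K d - K1 d * d); split=> //.
split=> //; last by move=> x; exact: prim_le0.
- by move=> x; rewrite mulr_ge0 ?flat_ge0.
- move=> x; rewrite in_itv/= negb_and -!ltNge => /orP[/ltW|/ltW]; last exact: rhod.
  exact: rho0.
Qed.

End SmoothFunctions.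

Section DuBoisReymond.
Context {R : realType}.
Implicit Types (w K rho : R -> R) (p q r x y d : R).
Local Notation L := (pi / 2 : R).

Lemma halfpi_gt0 : 0 < L.
Proof. by rewrite divr_gt0 ?pi_gt0. Qed.

Lemma halfpi_le : - L <= L.
Proof. by have := halfpi_gt0; lra. Qed.

Lemma itgB a b (f g : R -> R) : itg a b f -> itg a b g -> itg a b (fun x => f x - g x).
Proof.
move=> fi gi; apply: eq_integrable (itgD fi (itgZ (-1) gi)) => // x _ /=.
by rewrite mulN1r.
Qed.

Lemma primB a b (f g : R -> R) x : itg a b f -> itg a b g -> x \in `[a, b] ->
  prim a (fun x => f x - g x) x = prim a f x - prim a g x.
Proof. by move=> fi gi xab; rewrite /prim RintegralB//; exact: itg_sub xab. Qed.

Lemma bump_average w x (e : R) : {within `[- L, L], continuous w} ->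
  x \in `]- L, L[ -> 0 < e ->
  exists2 d0, 0 < d0 & forall d, 0 < d -> d <= d0 -> x + d < L /\
    forall rho m, continuous rho -> (forall y, 0 <= rho y) ->
      (forall y, y \notin `[0, d] -> rho y = 0) ->
      prim (- L) (fun y => rho (1 * y + - x)) L = m ->
      `|prim (- L) (fun y => w y * rho (1 * y + - x)) L - w x * m| <= e * m.
Proof.
move=> wc xL e0.
have xL' : x \in `[- L, L] by exact: subset_itv_oo_cc xL.
have /andP[Lx xltL] : (- L < x) && (x < L) by move: xL; rewrite in_itv.
have [d1 d10 near_w] : exists2 d1, 0 < d1 &
    forall y, `|x - y| < d1 -> y \in `[- L, L] -> `|w y - w x| <= e.
  have /subspace_continuousP/(_ x xL')/cvgrPdist_le/(_ e e0) := wc.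
  rewrite near_withinE => -[d1 /= d10 H]; exists d1 => // y yd yL.
  by rewrite distrC; exact: (H y).
exists (Num.min (d1 / 2) ((L - x) / 2)).
  by rewrite lt_min !divr_gt0// subr_gt0.
move=> d d_gt0; rewrite le_min => /andP[dd1 dLx]; split; first by lra.
move=> rho m rhoc rho0 rhod <-.
set rx := fun y => rho (1 * y + - x).
have rxc : {within `[- L, L], continuous rx}.
  apply: continuous_subspaceT => y; apply: continuous_comp; last exact: rhoc.
  exact: is_derive_continuous (is_derive_affine 1 (- x) y).
have rxi : itg (- L) L rx by exact: within_continuous_itg.
have wri : itg (- L) L (fun y => w y * rx y) by exact: itgM_continuous wc rxi.
have LL : L \in `[- L, L] by rewrite in_itv/= halfpi_le lexx.
have -> : prim (- L) (fun y => w y * rx y) L - w x * prim (- L) rx L =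
    prim (- L) (fun y => w y * rx y - w x * rx y) L.
  by rewrite -(primZ (w x) rxi LL) -(primB wri _ LL)//; exact: itgZ.
rewrite -(primZ e rxi LL).
have di : itg (- L) L (fun y => w y * rx y - w x * rx y).
  by apply: itgB => //; exact: itgZ.
apply: le_trans (le_normr_Rintegral _ di) _ => //.
apply: le_Rintegral => //.
- by have := integrable_norm di; apply: eq_integrable.
- exact: itgZ.
move=> y yL; rewrite -mulrBl normrM (ger0_norm (rho0 _)).
have [|yd] := boolP (1 * y + - x \in `[0, d]); last by rewrite /rx rhod// !mulr0.
rewrite in_itv/= => /andP[y0 yd]; apply: ler_wpM2r; first exact: rho0.
by apply: near_w => //; rewrite distrC ger0_norm//; lra.
Qed.

Lemma test_function_collinear w : {within `[- L, L], continuous w} ->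
  (forall phi, test_function phi ->
     prim (- L) (fun x => w x * derive1n 2 phi x) L = 0) ->
  forall p q r, - L < p -> p < q -> q < r -> r < L ->
    (r - q) * w p - (r - p) * w q + (q - p) * w r = 0.
Proof.
move=> wc w0 p q r Lp pq qr rL; apply/eqP; rewrite -normr_le0.
apply/ler_addgt0Pr => e e0; rewrite add0r.
pose s := 2 * (r - p); have s0 : 0 < s by rewrite /s; lra.
have es : 0 < e / s by exact: divr_gt0.
have pL : p \in `]- L, L[ by rewrite in_itv/=; apply/andP; split; lra.
have qL : q \in `]- L, L[ by rewrite in_itv/=; apply/andP; split; lra.
have rL' : r \in `]- L, L[ by rewrite in_itv/=; apply/andP; split; lra.
have [dp dp0 Hp] := bump_average wc pL es.
have [dq dq0 Hq] := bump_average wc qL es.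
have [dr dr0 Hr] := bump_average wc rL' es.
pose d := Num.min dp (Num.min dq dr).
have d0 : 0 < d by rewrite !lt_min dp0 dq0.
have [ddp ddq ddr] : [/\ d <= dp, d <= dq & d <= dr].
  by rewrite /d !ge_min !lexx !orbT.
have {Hp}[pdL Hp] := Hp d d0 ddp.
have {Hq}[qdL Hq] := Hq d d0 ddq.
have {Hr}[rdL Hr] := Hr d d0 ddr.
have [K [K1 [rho [m [c [sK DK [srho DK1] [rho0 rhod K0 K10] [m0 K1m Km]]]]]]] :=
  exists_smooth_ramp d0.
pose sh (f : R -> R) x y := f (1 * y + - x).
have Dsh (f g : R -> R) x : (forall y, is_derive y 1 f (g y)) ->
    forall y, is_derive y 1 (sh f x) (sh g x y).
  move=> D y; have := is_derive1_comp (D _) (is_derive_affine 1 (- x) y).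
  by rewrite mulr1.
(* The second derivative of [lin K] approximates a combination of Dirac masses
   at [p], [q], [r]; past [r + d] the affine parts of the ramps cancel. *)
pose lin (f : R -> R) y := (r - q) * sh f p y + (- (r - p) * sh f q y + (q - p) * sh f r y).
have Dlin (f g : R -> R) : (forall y, is_derive y 1 f (g y)) ->
    forall y, is_derive y 1 (lin f) (lin g y).
  by move=> D y; apply: is_derive_add.
have phiT : test_function (lin K).
  split=> [n x|].
    apply: smooth_derivable1n; apply: smooth_add; last apply: smooth_add;
    by (apply: smooth_mul; [exact: smooth_cst|exact: smooth_affine]).
  exists p, (r + d); split=> // x; rewrite in_itv/= negb_and -!ltNge => /orP[xp|rx].
    by rewrite /lin /sh !K0 ?mulr0 ?addr0//; lra.
  rewrite /lin /sh !Km; [ring|lra..].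
have phi2 : derive1n 2 (lin K) = lin rho.
  by rewrite derive1Sn (is_derive_derive1E (Dlin _ _ DK)) derive1n1
    (is_derive_derive1E (Dlin _ _ DK1)).
have rhoc := smooth_continuous srho.
have mE x : x \in `]- L, L[ -> x + d < L -> prim (- L) (sh rho x) L = m.
  rewrite in_itv/= => /andP[Lx xL] xdL.
  have shc : continuous (sh rho x).
    move=> y; apply: continuous_comp; last exact: rhoc.
    exact: is_derive_continuous (is_derive_affine 1 (- x) y).
  have [_ /(_ L)] := AC_C1 halfpi_le (Dsh _ _ x DK1) shc.
  rewrite {1 2}/sh K1m; last by lra.
  rewrite (K10 (1 * - L + - x)); last by lra.
  by rewrite add0r => <-//; rewrite in_itv/= halfpi_le lexx.
have Ep := Hp rho m rhoc rho0 rhod (mE p pL pdL).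
have Eq := Hq rho m rhoc rho0 rhod (mE q qL qdL).
have Er := Hr rho m rhoc rho0 rhod (mE r rL' rdL).
have shi x : itg (- L) L (fun y => w y * sh rho x y).
  apply: itgM_continuous => //; apply/within_continuous_itg/continuous_subspaceT.
  move=> y; apply: continuous_comp; last exact: rhoc.
  exact: is_derive_continuous (is_derive_affine 1 (- x) y).
pose J x := prim (- L) (fun y => w y * sh rho x y) L.
have LL : L \in `[- L, L] by rewrite in_itv/= halfpi_le lexx.
have J0 : (r - q) * J p + (- (r - p) * J q + (q - p) * J r) = 0.
  rewrite -(w0 _ phiT) phi2 /J.
  rewrite -(primZ _ (shi p) LL) -(primZ _ (shi q) LL) -(primZ _ (shi r) LL).
  rewrite -(primD _ _ LL) -?(primD _ _ LL); try by do ?apply: itgD; exact: itgZ.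
  by apply: eq_Rintegral => y _; rewrite /lin; ring.
rewrite -/(J p) in Ep; rewrite -/(J q) in Eq; rewrite -/(J r) in Er.
suff : `|(r - q) * w p - (r - p) * w q + (q - p) * w r| * m <= e * m.
  by rewrite ler_pM2r.
have -> : e * m = (r - q) * (e / s * m) + (r - p) * (e / s * m) + (q - p) * (e / s * m).
  by rewrite -{1}(divfK (lt0r_neq0 s0) e) /s; ring.
rewrite -(gtr0_norm m0) -normrM (gtr0_norm m0).
have -> : ((r - q) * w p - (r - p) * w q + (q - p) * w r) * m =
  - ((r - q) * (J p - w p * m)) + (r - p) * (J q - w q * m) - (q - p) * (J r - w r * m).
  apply/eqP; rewrite -subr_eq0; apply/eqP; rewrite -[RHS]J0; ring.
apply: le_trans (ler_normB _ _) _; apply: lerD; last first.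
  by rewrite normrM gtr0_norm ?subr_gt0// ler_wpM2l// subr_ge0 ltW.
apply: le_trans (ler_normD _ _) _; apply: lerD.
  by rewrite normrN normrM gtr0_norm ?subr_gt0// ler_wpM2l// subr_ge0 ltW.
have pr := lt_trans pq qr.
by rewrite normrM gtr0_norm ?subr_gt0// ler_wpM2l// subr_ge0 ltW.
Qed.

Lemma du_bois_reymond2 w : {within `[- L, L], continuous w} ->
  (forall phi, test_function phi ->
     prim (- L) (fun x => w x * derive1n 2 phi x) L = 0) ->
  exists al be : R, forall x, x \in `[- L, L] -> w x = al + be * x.
Proof.
move=> wc w0; have H := test_function_collinear wc w0.
have L0 := halfpi_gt0.
pose p0 := - (L / 2); pose r0 := L / 2.
pose be := (w r0 - w p0) / (r0 - p0); pose al := w p0 - be * p0.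
have rp0 : r0 - p0 != 0 by rewrite lt0r_neq0// /r0 /p0; lra.
have beE : be * (r0 - p0) = w r0 - w p0 by rewrite /be divfK.
have inner x : x \in `]- L, L[ -> w x = al + be * x.
  rewrite in_itv/= => /andP[Lx xL].
  suff : (r0 - p0) * (w x - (al + be * x)) = 0.
    by move/eqP; rewrite mulf_eq0 (negbTE rp0)/= subr_eq0 => /eqP.
  have -> : (r0 - p0) * (w x - (al + be * x)) =
      (r0 - p0) * (w x - w p0) - (w r0 - w p0) * (x - p0).
    by rewrite -beE /al; ring.
  have Lp0 : - L < p0 by rewrite /p0; lra.
  have r0L : r0 < L by rewrite /r0; lra.
  have p0r0 : p0 < r0 by rewrite /p0 /r0; lra.
  have [xp|xp|->] := ltgtP x p0; last by rewrite !subrr !mulr0 subrr.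
    by rewrite -(H x p0 r0)//; ring.
  have [xr|xr|->] := ltgtP x r0; last by ring.
    by rewrite -[RHS]oppr0 -(H p0 x r0)//; ring.
  by rewrite -(H p0 r0 x)//; ring.
have LL : - L < L by lra.
have [_ wl wr] := (continuous_within_itvP w LL).1 wc.
have ac : continuous (fun x => al + be * x).
  move=> x; apply: (@is_derive_continuous _ (fun x => al + be * x) be).
  rewrite (_ : (fun x => _) = (fun x => be * x + al)); first exact: is_derive_affine.
  by apply/funext => y; rewrite addrC.
exists al, be => x; rewrite in_itv/= => /andP[].
rewrite le_eqVlt => /predU1P[<- _|Lx].
  have H1 : al + be * x @[x --> (- L)^'+] --> w (- L).
    apply: cvg_trans wl; apply: near_eq_cvg; near=> y.
    by rewrite inner// in_itv/=; apply/andP; split=> //.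
  exact: (cvg_unique _ H1 (cvg_at_right_filter (ac _))).
rewrite le_eqVlt => /predU1P[->|xL]; last by rewrite inner// in_itv/= Lx.
have H1 : al + be * x @[x --> L^'-] --> w L.
  apply: cvg_trans wr; apply: near_eq_cvg; near=> y.
  by rewrite inner// in_itv/=; apply/andP; split=> //.
exact: (cvg_unique _ H1 (cvg_at_left_filter (ac _))).
Unshelve. all: by end_near. Qed.

End DuBoisReymond.

Section RestrictedMeasure.
Context {R : realType}.
Implicit Types (f g : R -> R) (x : R).
Local Notation L := (pi / 2 : R).
Local Notation leb := (@lebesgue_measure R).
Local Notation mu := (@muI R).
Local Notation II := ([set` `[(- L)%R, L]] : set R).

Lemma mem_halfpi : L \in `[- L, L].
Proof. by rewrite in_itv/= halfpi_le lexx. Qed.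

Lemma muIE A : mu A = leb (A `&` I_open).
Proof. by []. Qed.

Lemma muI_compl : mu (~` I_open) = 0%E.
Proof. by rewrite muIE setICl measure0. Qed.

Lemma muI_fin : mu setT \is a fin_num.
Proof.
rewrite muIE setTI /I_open lebesgue_measure_itv /=.
by case: ifP => // _; rewrite -EFinD.
Qed.

Lemma integral_muI (f : R -> \bar R) : measurable_fun (setT : set (measurableTypeR R)) f ->
  (\int[mu]_x f x = \int[leb]_(x in II) f x)%E.
Proof.
move=> mf.
have mI : measurable (I_open : set (measurableTypeR R)) by exact: measurable_I_open.
have mfI : measurable_fun setT (f \_ I_open).
  apply: (measurable_restrictT f mI).1. exact: measurable_funTS mf.
have -> : (\int[mu]_x f x = \int[mu]_(x in I_open) f x)%E.
  rewrite [RHS]integral_mkcond; apply: ae_eq_integral => //.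
  exists (~` I_open); split; [exact: measurableC|exact: muI_compl|].
  move=> x /= nfx Ix; apply: nfx => _.
  by rewrite patchE mem_set.
rewrite (eq_measure_integral leb); last first.
  by move=> A mA AI; rewrite muIE (setIidl AI).
rewrite integral_itv_bndo_bndc; last exact: measurable_funTS mf.
by rewrite integral_itv_obnd_cbnd//; exact: measurable_funTS mf.
Qed.

Lemma ae_muI U (f g : R -> U) :
  ae_eq mu setT f g <-> ae_eq leb II f g.
Proof.
have mI : measurable (I_open : set (measurableTypeR R)) by exact: measurable_I_open.
split=> -[A [mA A0 fgA]].
  have mAI := measurableI _ _ mA mI.
  have m1 x : measurable ([set x] : set (measurableTypeR R)) by exact: measurable_set1.
  exists (A `&` I_open `|` [set - L] `|` [set L]); split.
  - by do 2 apply: measurableU => //.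
  - rewrite (measureU0 (mu := leb) (measurableU _ _ mAI (m1 _)) (m1 _) (lebesgue_measure_set1 _)).
    by rewrite (measureU0 (mu := leb) mAI (m1 _) (lebesgue_measure_set1 _)).
  - move=> x /= nfg.
    have [xL|/negP xL] := boolP (x \in `[- L, L]); last by exfalso; apply: nfg.
    have [->|xNL] := eqVneq x L; [by right|left].
    have [->|xNL'] := eqVneq x (- L); [by right|left]; split.
      by apply: fgA => /= H; apply: nfg => _; exact: H.
    by move: xL; rewrite /I_open /= !in_itv/= !le_eqVlt (negbTE xNL) eq_sym (negbTE xNL').
exists (A `|` ~` I_open); split.
- by apply: measurableU => //; exact: measurableC.
- rewrite muIE setIUl setICl setU0; apply/eqP; rewrite -measure_le0 -A0.
  by apply: le_measure; rewrite ?inE//; exact: measurableI.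
- move=> x /= nfg; have [xI|xI] := pselect (I_open x); [left|by right].
  by apply: fgA => /= H; apply: nfg => _; apply: H; exact: subset_itv_oo_cc xI.
Qed.

Lemma Lfun_muI_itg f : f \in Lfun mu 2%:E -> itg (- L) L f.
Proof.
move=> /(Lfun_subset12 muI_fin) /Lfun1_integrable /integrableP[mf fi].
apply/integrableP; split; first exact: measurable_funTS mf.
by move: fi; rewrite integral_muI//; apply: measurableT_comp mf.
Qed.

Lemma bounded_Lfun_muI f (M : R) : measurable_fun setT f ->
  (forall x, x \in `[- L, L] -> `|f x| <= M) -> f \in Lfun mu 2%:E.
Proof.
move=> mf fM; have M0 : 0 <= M := le_trans (normr_ge0 _) (fM _ mem_halfpi).
have mp : measurable_fun (setT : set (measurableTypeR R)) (fun x => (`|f x| `^ 2)%:E).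
  apply/measurable_EFinP; apply: (measurableT_comp (measurable_powR _)) => //.
  exact: measurableT_comp.
rewrite inE; apply/andP; split; rewrite inE//=.
rewrite /finite_norm unlock poweR_lty// integral_muI//.
apply: (@le_lt_trans _ _ (\int[leb]_(x in II) (M `^ 2)%:E)%E).
  apply: ge0_le_integral => //.
  - by move=> x _; exact: poweR_ge0.
  - exact: measurable_funTS mp.
  - move=> x xL; rewrite lee_fin ge0_ler_powR ?nnegrE//.
    exact: fM.
rewrite integral_cst//= lebesgue_measure_itv/=.
by case: ifP => _; rewrite ?mule0 ?ltry// -EFinD -EFinM ltry.
Qed.

Lemma Rintegral_muI f : f \in Lfun mu 1 -> \int[mu]_x f x = prim (- L) f L.
Proof.
move=> /Lfun1_integrable /integrableP[mf fi].
by rewrite /prim /Rintegral integral_muI.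
Qed.

Lemma Lfun_muID f g : f \in Lfun mu 2%:E -> g \in Lfun mu 2%:E ->
  (fun x => f x + g x) \in Lfun mu 2%:E.
Proof. by move=> fL gL; have [_ +] := Lfun_addr_closed mu (lee1n 2); apply. Qed.

Lemma eq_Lfun_muI f g : f =1 g -> f \in Lfun mu 2%:E -> g \in Lfun mu 2%:E.
Proof. by move=> /funext ->. Qed.

Lemma Lfun_muIZ k f : f \in Lfun mu 2%:E -> (fun x => k * f x) \in Lfun mu 2%:E.
Proof.
move=> fL; by apply: eq_Lfun_muI (@Lfun_scale _ _ _ mu f k 2 (ler1n _ 2) fL) => x /=; rewrite mulrC.
Qed.

Lemma Lfun_measurable f : f \in Lfun mu 2%:E -> measurable_fun setT f.
Proof. by rewrite inE => /andP[/[!inE]]. Qed.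

End RestrictedMeasure.

Section ComplexAC.
Context {R : realType}.
Local Notation L := (pi / 2 : R).
Local Notation leb := (@lebesgue_measure R).
Local Notation mu := (@muI R).
Local Notation II := ([set` `[(- L)%R, L]] : set R).
Local Notation Re := (@complex.Re R).
Local Notation Im := (@complex.Im R).
Local Notation C := (R[i]).
Implicit Types (F G f g : R -> C) (k : C).

Lemma cReD (z w : C) : Re (z + w) = Re z + Re w.
Proof. by case: z w => [? ?] []. Qed.
Lemma cImD (z w : C) : Im (z + w) = Im z + Im w.
Proof. by case: z w => [? ?] []. Qed.
Lemma cReM (z w : C) : Re (z * w) = Re z * Re w + - 1 * (Im z * Im w).
Proof. by rewrite mulN1r; case: z w => [? ?] []. Qed.
Lemma cImM (z w : C) : Im (z * w) = Re z * Im w + Im z * Re w.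
Proof. by case: z w => [? ?] []. Qed.
Lemma cReN (z : C) : Re (- z) = - Re z.
Proof. by case: z. Qed.
Lemma cImN (z : C) : Im (- z) = - Im z.
Proof. by case: z. Qed.

Lemma complex_ext (z w : C) : Re z = Re w -> Im z = Im w -> z = w.
Proof. by case: z w => [? ?] [? ?] /= -> ->. Qed.

Definition CAC F f : Prop :=
  AC (- L) L (Re \o F) (Re \o f) /\ AC (- L) L (Im \o F) (Im \o f).

Lemma CAC_eq F G f g : CAC F f -> {in `[- L, L], F =1 G} -> {in `[- L, L], f =1 g} ->
  CAC G g.
Proof.
move=> [rF iF] FG fg; split.
- apply: AC_eq_deriv (AC_eq rF _) _ => x xL /=; [by rewrite FG|by rewrite fg].
- apply: AC_eq_deriv (AC_eq iF _) _ => x xL /=; [by rewrite FG|by rewrite fg].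
Qed.

Lemma CAC_cst k : CAC (fun=> k) (fun=> 0).
Proof. by split; exact: AC_cst. Qed.

Lemma CACD F G f g : CAC F f -> CAC G g -> CAC (fun x => F x + G x) (fun x => f x + g x).
Proof.
move=> [rF iF] [rG iG]; split.
- by apply: AC_eq_deriv (AC_eq (ACD rF rG) _) _ => x _ /=; rewrite cReD.
- by apply: AC_eq_deriv (AC_eq (ACD iF iG) _) _ => x _ /=; rewrite cImD.
Qed.

Lemma CACM F G f g : CAC F f -> CAC G g ->
  CAC (fun x => F x * G x) (fun x => f x * G x + F x * g x).
Proof.
have LL := @halfpi_le R.
move=> [rF iF] [rG iG]; split.
- apply: AC_eq_deriv (AC_eq (ACD (ACM LL rF rG) (ACZ (-1) (ACM LL iF iG))) _) _ => x _ /=.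
    by rewrite cReM.
  by rewrite cReD !cReM; ring.
- apply: AC_eq_deriv (AC_eq (ACD (ACM LL rF iG) (ACM LL iF rG)) _) _ => x _ /=.
    by rewrite cImM.
  by rewrite cImD !cImM; ring.
Qed.

Lemma CACZ k F f : CAC F f -> CAC (fun x => k * F x) (fun x => k * f x).
Proof.
move=> Ff; apply: CAC_eq (CACM (CAC_cst k) Ff) _ _ => x _ //.
by rewrite mul0r add0r.
Qed.

Lemma CAC_ae F f g : CAC F f -> measurable_fun II (Re \o g) ->
  measurable_fun II (Im \o g) -> ae_eq leb II f g -> CAC F g.
Proof.
move=> [rF iF] mr mi fg; split.
- by apply: AC_ae rF mr _; exact: ae_eq_comp fg.
- by apply: AC_ae iF mi _; exact: ae_eq_comp fg.
Qed.

Lemma CAC0_cst F x : CAC F (fun=> 0) -> x \in `[- L, L] -> F x = F (- L).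
Proof.
move=> [rF iF] xL; apply: complex_ext; first exact: (AC0_cst rF xL).
exact: (AC0_cst iF xL).
Qed.

Lemma CAC_continuous F f : CAC F f -> continuous_on_closure F.
Proof.
have LL := @halfpi_le R; move=> [rF iF].
by split; [exact: AC_continuous LL rF|exact: AC_continuous LL iF].
Qed.

Definition Citg f := itg (- L) L (Re \o f) /\ itg (- L) L (Im \o f).

Definition Cprim f x : C := (prim (- L) (Re \o f) x) +i* (prim (- L) (Im \o f) x).

Lemma CAC_Cprim f : Citg f -> CAC (Cprim f) f.
Proof. by case=> ? ?; split; exact: AC_prim. Qed.

Lemma CAC_primE F f x : CAC F f -> x \in `[- L, L] -> F x = F (- L) + Cprim f x.
Proof.
move=> [[_ rF] [_ iF]] xL; apply: complex_ext.
- by rewrite cReD /=; exact: rF.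
- by rewrite cImD /=; exact: iF.
Qed.

Lemma Cprim0 f : Cprim f (- L) = 0.
Proof. by rewrite /Cprim !prim0. Qed.

Lemma cL2D f g : cL2 mu f -> cL2 mu g -> cL2 mu (fun x => f x + g x).
Proof.
move=> [rf im_f] [rg ig]; split.
- by apply: eq_Lfun_muI (Lfun_muID rf rg) => x; rewrite cReD.
- by apply: eq_Lfun_muI (Lfun_muID im_f ig) => x; rewrite cImD.
Qed.

Lemma cL2Z k f : cL2 mu f -> cL2 mu (fun x => k * f x).
Proof.
move=> [rf im_f]; split.
- have H := Lfun_muID (Lfun_muIZ (Re k) rf) (Lfun_muIZ (-1) (Lfun_muIZ (Im k) im_f)).
  by apply: eq_Lfun_muI H => x; rewrite cReM.
- have H := Lfun_muID (Lfun_muIZ (Re k) im_f) (Lfun_muIZ (Im k) rf).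
  by apply: eq_Lfun_muI H => x; rewrite cImM.
Qed.

Lemma cL2N f : cL2 mu f -> cL2 mu (fun x => - f x).
Proof.
by move=> /(cL2Z (-1)); under eq_fun do rewrite mulN1r.
Qed.

Lemma cL2_Citg f : cL2 mu f -> Citg f.
Proof. by move=> [/Lfun_muI_itg ? /Lfun_muI_itg ?]. Qed.

Definition patchI F : R -> C := fun x => if (- L <= x) && (x <= L) then F x else 0.

Lemma patchIE F : {in `[- L, L], patchI F =1 F}.
Proof. by move=> x; rewrite in_itv/= /patchI => ->. Qed.

Lemma cL2_patchI F : continuous_on_closure F -> cL2 mu (patchI F).
Proof.
have bd (f : R -> R) : {within `[- L, L], continuous f} ->
    (f \_ `[- L, L]) \in Lfun mu 2%:E.
  move=> fc; have [M [Mr fM]] := within_continuous_bounded fc.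
  apply: (@bounded_Lfun_muI _ _ (M + 1)).
    have mI : measurable (II : set (measurableTypeR R)) by exact: measurable_itv.
    apply: (measurable_restrictT f mI).1.
    exact: within_continuous_measurable.
  move=> x xL; rewrite patch_itvE; move: (xL); rewrite in_itv/= => ->.
  apply: (fM (M + 1)); last exact: xL.
  by rewrite ltrDl.
move=> [/bd rF /bd iF]; split.
- by apply: eq_Lfun_muI rF => x; rewrite patch_itvE /patchI; case: ifP.
- by apply: eq_Lfun_muI iF => x; rewrite patch_itvE /patchI; case: ifP.
Qed.

End ComplexAC.

Section WeakDerivatives.
Context {R : realType}.
Local Notation L := (pi / 2 : R).
Local Notation mu := (@muI R).
Local Notation Re := (@complex.Re R).
Local Notation Im := (@complex.Im R).
Local Notation C := (R[i]).
Implicit Types (F G f g u v U V : R -> C) (k : C) (phi : R -> R).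

Lemma test_function_is_derive phi (n : nat) (x : R) : test_function phi ->
  is_derive x 1 (derive1n n phi) (derive1n n.+1 phi x).
Proof. by move=> [D _]; apply: DeriveDef => //; rewrite derive1nS derive1E. Qed.

Lemma test_function_continuous phi (n : nat) : test_function phi -> continuous (derive1n n phi).
Proof. by move=> /test_function_is_derive D x; exact: is_derive_continuous (D n x). Qed.

Lemma test_function_derive phi : test_function phi -> test_function (derive1 phi).
Proof.
move=> tphi; have [D [c [e [Lc eL phi0]]]] := tphi; split.
  by move=> n x; rewrite -derive1Sn; exact: D.
exists c, e; split=> // x; rewrite in_itv/= negb_and -!ltNge => xce.
have Dx := test_function_is_derive 0 x tphi.
rewrite derive1n0 derive1n1 in Dx.
suff D0 : is_derive x 1 phi 0 by case: Dx D0 => _ <- [_ ->].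
apply: (@near_eq_is_derive _ _ _ (fun=> 0)).
case/orP: xce => xc; near=> y; rewrite phi0// in_itv/= negb_and -!ltNge.
- by apply/orP; left; near: y; exact: lt_nbhsl.
- by apply/orP; right; near: y; exact: lt_nbhsr.
Unshelve. all: by end_near. Qed.

Lemma test_function_bd phi : test_function phi -> phi (- L) = 0 /\ phi L = 0.
Proof.
move=> [_ [c [e [Lc eL phi0]]]]; split; apply: phi0;
rewrite in_itv/= negb_and -!ltNge.
- by rewrite Lc.
- by rewrite eL orbT.
Qed.

Lemma CAC_test phi : test_function phi ->
  CAC (fun x => (phi x)%:C) (fun x => (derive1 phi x)%:C).
Proof.
move=> tphi; split; last exact: AC_cst.
apply: AC_C1; first exact: halfpi_le.
  by move=> x; have := test_function_is_derive 0 x tphi; rewrite derive1n0 derive1n1.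
by have := test_function_continuous (n := 1) tphi; rewrite derive1n1.
Qed.

Lemma Cprim_eq f g x : {in `[- L, L], f =1 g} -> x \in `[- L, L] ->
  Cprim f x = Cprim g x.
Proof.
move=> fg xL; have sub y : y \in `[- L, x] -> y \in `[- L, L].
  by rewrite !in_itv/= => /andP[-> /le_trans]; apply; rewrite (itvP xL).
by congr (_ +i* _); apply: eq_Rintegral => y; rewrite inE/= => /sub /fg ->.
Qed.

Lemma CprimD f g x : Citg f -> Citg g -> x \in `[- L, L] ->
  Cprim (fun x => f x + g x) x = Cprim f x + Cprim g x.
Proof.
move=> [rf mf] [rg mg] xL; apply: complex_ext.
- rewrite cReD /= -(primD rf rg xL); apply: eq_Rintegral => y _ /=; exact: cReD.
- rewrite cImD /= -(primD mf mg xL); apply: eq_Rintegral => y _ /=; exact: cImD.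
Qed.

Lemma CprimN f x : Citg f -> x \in `[- L, L] ->
  Cprim (fun x => - f x) x = - Cprim f x.
Proof.
move=> [rf mf] xL; apply: complex_ext.
- rewrite cReN /= -[RHS]mulN1r -(primZ _ rf xL); apply: eq_Rintegral => y _ /=.
  by rewrite cReN mulN1r.
- rewrite cImN /= -[RHS]mulN1r -(primZ _ mf xL); apply: eq_Rintegral => y _ /=.
  by rewrite cImN mulN1r.
Qed.

Lemma cL2_itg_mul f phi : cL2 mu f -> continuous phi ->
  Citg (fun x => f x * (phi x)%:C) /\
  cintegral mu (fun x => f x * (phi x)%:C) = Cprim (fun x => f x * (phi x)%:C) L.
Proof.
move=> f2 phic; have [rf mf] := f2.
have rE x : Re (f x * (phi x)%:C) = phi x * Re (f x).
  by rewrite cReM /= mulr0 mulr0 addr0 mulrC.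
have iE x : Im (f x * (phi x)%:C) = phi x * Im (f x).
  by rewrite cImM /= mulr0 add0r mulrC.
have phiw : {within `[- L, L], continuous phi} by exact: continuous_subspaceT.
have phi2 : phi \in Lfun mu 2%:E.
  have [M [Mr fM]] := within_continuous_bounded phiw.
  apply: (@bounded_Lfun_muI _ _ (M + 1)); first exact: continuous_measurable_fun.
  by move=> x xL; apply: (fM (M + 1)) => //; rewrite ltrDl.
split; first split.
- apply: eq_integrable (itgM_continuous phiw (Lfun_muI_itg rf)) => // x _ /=.
  by rewrite rE.
- apply: eq_integrable (itgM_continuous phiw (Lfun_muI_itg mf)) => // x _ /=.
  by rewrite iE.
rewrite /cintegral /Cprim; congr (_ +i* _).
- rewrite (_ : (fun _ => Re _) = phi \* (Re \o f)).
    by rewrite Rintegral_muI; [apply: eq_Rintegral => x _ /=; rewrite rE|exact: Lfun2_mul_Lfun1].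
  by apply/funext => x; rewrite rE.
- rewrite (_ : (fun _ => Im _) = phi \* (Im \o f)).
    by rewrite Rintegral_muI; [apply: eq_Rintegral => x _ /=; rewrite iE|exact: Lfun2_mul_Lfun1].
  by apply/funext => x; rewrite iE.
Qed.

Lemma weak_derivative1_AC U v : cL2 mu U -> cL2 mu v -> CAC U v -> weak_derivative 1 U v.
Proof.
move=> U2 v2 Uv phi tphi; rewrite derive1n1 expr1 mulN1r.
have c1 : continuous (derive1 phi).
  by have := test_function_continuous (n := 1) tphi; rewrite derive1n1.
have c0 : continuous phi by have := test_function_continuous (n := 0) tphi.
have [i1 ->] := cL2_itg_mul U2 c1; have [i0 ->] := cL2_itg_mul v2 c0.
have LL := @mem_halfpi R.
have := CAC_primE (CACM Uv (CAC_test tphi)) LL.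
have [-> ->] := test_function_bd tphi; rewrite !mulr0 add0r CprimD//.
by move/eqP; rewrite eq_sym addrC addr_eq0 => /eqP.
Qed.

Lemma weak_derivative2_AC U V w : cL2 mu U -> cL2 mu V -> cL2 mu w ->
  CAC U V -> CAC V w -> weak_derivative 2 U w.
Proof.
move=> U2 V2 w2 UV Vw phi tphi.
have := weak_derivative1_AC U2 V2 UV (test_function_derive tphi).
have := weak_derivative1_AC V2 w2 Vw tphi.
rewrite expr1 !mulN1r => E; rewrite -derive1Sn => ->; rewrite -derive1n1 E.
by rewrite opprK sqrrN expr1n mul1r.
Qed.

End WeakDerivatives.

Section OperatorGraph.
Context {R : realType}.
Local Notation L := (pi / 2 : R).
Local Notation leb := (@lebesgue_measure R).
Local Notation mu := (@muI R).
Local Notation II := ([set` `[(- L)%R, L]] : set R).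
Local Notation Re := (@complex.Re R).
Local Notation Im := (@complex.Im R).
Local Notation C := (R[i]).
Implicit Types (F G f g u v U V : R -> C) (k : C) (phi : R -> R).

Lemma halfpi_in (a : R) : -1 < a < 1 -> L * a \in `]- L, L[.
Proof.
move=> /andP[a1 a2]; have L0 := @halfpi_gt0 R; rewrite in_itv/=; apply/andP; split.
  by rewrite -mulrN1 ltr_pM2l.
by rewrite -[ltRHS]mulr1 ltr_pM2l.
Qed.

Lemma memNhalfpi : - L \in `[- L, L].
Proof. by rewrite in_itv/= halfpi_le lexx. Qed.

Lemma CAC_patchI F f : CAC F f -> CAC (patchI F) f.
Proof. by move=> Ff; apply: CAC_eq Ff _ _ => x xL //; rewrite patchIE. Qed.

Lemma CAC_patchI_deriv F f : CAC F f -> CAC F (patchI f).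
Proof. by move=> Ff; apply: CAC_eq Ff _ _ => x xL //; rewrite patchIE. Qed.

Lemma CAC_cL2 F f : CAC F f -> cL2 mu (patchI F).
Proof. by move=> /CAC_continuous /cL2_patchI. Qed.

Lemma CAC_affine k1 k2 : CAC (fun x => k1 + k2 * x%:C) (fun=> k2).
Proof.
have Dx : CAC (fun x : R => x%:C) (fun=> 1).
  split; last exact: AC_cst.
  have D (x : R) : is_derive x (1 : R) (fun y : R => y) 1 by exact: is_derive_id.
  have c1 : continuous (fun _ : R => 1 : R) by move=> x; exact: cvg_cst.
  have H := AC_C1 (@halfpi_le R) D c1.
  exact: H.
apply: CAC_eq (CACD (CAC_cst k1) (CACZ k2 Dx)) _ _ => x _ //.
by rewrite mulr1 add0r.
Qed.

Lemma continuous_on_closure_itg F : continuous_on_closure F -> Citg F.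
Proof. by case=> ? ?; split; exact: within_continuous_itg. Qed.

(* Subtracting from [u] the double integral of [g] leaves a continuous function
   with vanishing weak second derivative, hence an affine one. *)
Lemma weak_derivative2_CAC u g : cL2 mu u -> cL2 mu g -> continuous_on_closure u ->
  weak_derivative 2 u g -> exists2 V, CAC u V & CAC V g.
Proof.
move=> u2 g2 uc ug.
pose w1 := Cprim g; pose w2 := Cprim w1.
have w1g : CAC w1 g := CAC_Cprim (cL2_Citg g2).
have w2w1 : CAC w2 w1 := CAC_Cprim (continuous_on_closure_itg (CAC_continuous w1g)).
pose p2 := patchI w2; pose p1 := patchI w1.
have wd : weak_derivative 2 p2 g.
  apply: (weak_derivative2_AC (CAC_cL2 w2w1) (CAC_cL2 w1g) g2).
    exact/CAC_patchI/CAC_patchI_deriv.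
  exact: CAC_patchI.
pose w x := u x - p2 x.
have p2c : continuous_on_closure p2 := CAC_continuous (CAC_patchI w2w1).
have w0 phi : test_function phi -> Cprim (fun x => w x * (derive1n 2 phi x)%:C) L = 0.
  move=> tphi; have c2 := test_function_continuous (n := 2) tphi.
  have [i1 E1] := cL2_itg_mul u2 c2.
  have [i2 E2] := cL2_itg_mul (CAC_cL2 w2w1) c2.
  have := ug phi tphi; rewrite -(wd phi tphi) E1 E2 => E.
  rewrite -E1 -E2 in E; have [ri2 mi2] := i2.
  have Ni2 : Citg (fun x => - (p2 x * (derive1n 2 phi x)%:C)).
    split.
    - by apply: eq_integrable (itgZ (-1) ri2) => // x _ /=; rewrite cReN mulN1r.
    - by apply: eq_integrable (itgZ (-1) mi2) => // x _ /=; rewrite cImN mulN1r.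
  transitivity (Cprim (fun x => u x * (derive1n 2 phi x)%:C - p2 x * (derive1n 2 phi x)%:C) L).
    by apply: Cprim_eq (@mem_halfpi R) => x _; rewrite mulrBl.
  rewrite CprimD//; last exact: mem_halfpi.
  rewrite CprimN//; last exact: mem_halfpi.
  by rewrite -E1 -E2 E subrr.
have aff (P : C -> R) : (forall z y, P (z * y%:C) = P z * y) ->
    {within `[- L, L], continuous (P \o w)} ->
    (forall phi, test_function phi ->
      prim (- L) (fun x => P (w x * (derive1n 2 phi x)%:C)) L = 0) ->
    exists al be : R, forall x, x \in `[- L, L] -> P (w x) = al + be * x.
  move=> PM Pc P0; apply: (du_bois_reymond2 Pc) => phi /P0 E.
  by rewrite -[RHS]E; apply: eq_Rintegral => x _; rewrite PM.
have withinB (F1 F2 : R -> R) : {within `[- L, L], continuous F1} ->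
    {within `[- L, L], continuous F2} -> {within `[- L, L], continuous (fun x => F1 x - F2 x)}.
  move=> /subspace_continuousP c1 /subspace_continuousP c2.
  by apply/subspace_continuousP => x xL; apply: cvgB; [exact: c1|exact: c2].
have [uc1 uc2] := uc; have [pc1 pc2] := p2c.
have wE (x : R) : Re (w x) = Re (u x) - Re (p2 x) by rewrite cReD cReN.
have wE' (x : R) : Im (w x) = Im (u x) - Im (p2 x) by rewrite cImD cImN.
have [al [be rw]] : exists al be : R, forall x, x \in `[- L, L] -> Re (w x) = al + be * x.
  apply: aff.
  - by move=> z y; rewrite cReM /= !mulr0 addr0.
  - rewrite (_ : Re \o w = fun x => Re (u x) - Re (p2 x)); first exact: withinB.
    exact/funext.
  - by move=> phi /w0 /(congr1 Re).
have [al' [be' iw]] : exists al be : R, forall x, x \in `[- L, L] -> Im (w x) = al + be * x.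
  apply: aff.
  - by move=> z y; rewrite cImM /= !mulr0 add0r.
  - rewrite (_ : Im \o w = fun x => Im (u x) - Im (p2 x)); first exact: withinB.
    exact/funext.
  - by move=> phi /w0 /(congr1 Im).
exists (fun x => (be +i* be') + w1 x).
  apply: CAC_eq (CACD (CAC_affine (al +i* al') (be +i* be')) w2w1) _ _ => x xL //.
  have -> : (al +i* al') + (be +i* be') * x%:C = w x.
    by apply: complex_ext; [rewrite rw|rewrite iw]; rewrite //= !mulr0 ?subr0 ?add0r.
  by rewrite /w /p2 patchIE// subrK.
by apply: CAC_eq (CACD (CAC_cst (be +i* be')) w1g) _ _ => x xL //; rewrite add0r.
Qed.

Lemma opHP (a : R) f g : -1 < a < 1 ->
  opH a f g <-> [/\ cL2 mu f, cL2 mu g & exists U V,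
    [/\ CAC U V, CAC V (fun x => - g x), ae_eq leb II f U,
        U (- L) = U (L * a) & U (L * a) = U L]].
Proof.
move=> ha; have aL := subset_itv_oo_cc (halfpi_in ha).
split=> [[f2 g2 [u [[[u2 _] uc b1 b2] fu ug]]]|[f2 g2 [U [V [UV Vg fU b1 b2]]]]].
  have [V uV Vg] := weak_derivative2_CAC u2 (cL2N g2) uc ug.
  by split=> //; exists u, V; split=> //; exact/ae_muI.
split=> //; exists (patchI U).
have U2 := CAC_cL2 UV; have V2 := CAC_cL2 Vg; have Ng2 := cL2N g2.
have UVp : CAC (patchI U) (patchI V) by exact/CAC_patchI/CAC_patchI_deriv.
have Vgp := CAC_patchI Vg.
have wd2 := weak_derivative2_AC U2 V2 Ng2 UVp Vgp.
split=> //.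
- split.
  + split=> // -[|[|[|n]]]// _; last by exists (fun x => - g x).
    by exists (patchI V) => //; exact: weak_derivative1_AC.
  + exact: CAC_continuous UVp.
  + by rewrite (patchIE U memNhalfpi) (patchIE U aL).
  + by rewrite (patchIE U aL) (patchIE U (@mem_halfpi R)).
apply/ae_muI; apply: filterS fU => x /= fU xI; rewrite fU//.
by rewrite patchIE.
Qed.

End OperatorGraph.

Section FundamentalSolutions.
Context {R : realType}.
Local Notation Re := (@complex.Re R).
Local Notation Im := (@complex.Im R).
Local Notation C := (R[i]).
Implicit Types (lam mu : C) (c s : R -> C).

Lemma sin_zero (x : R) : 0 <= x -> sin x = 0 -> exists m : nat, x = pi * m%:R.
Proof.
move=> x0 sx; have p0 := pi_gt0 R.
pose m := Num.truncn (x / pi).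
have xp : 0 <= x / pi by rewrite divr_ge0// ltW.
have /andP[mx xm] := truncn_itv xp; rewrite -/m in mx xm.
have {}mx : 0 <= x - pi * m%:R by rewrite subr_ge0 mulrC -ler_pdivlMr.
have {}xm : x - pi * m%:R < pi.
  rewrite ltrBlDr; move: xm; rewrite ltr_pdivrMr// -natr1; lra.
have sr : sin (x - pi * m%:R) = 0.
  have := alternatingn (@sinDpi R) m (x - pi * m%:R).
  rewrite mulr_natr subrK sx => /esym/eqP.
  by rewrite mulf_eq0 signr_eq0/= => /eqP.
exists m; apply/eqP; rewrite -subr_eq0; apply/negPn/negP => xm0.
have : 0 < sin (x - pi * m%:R) by apply: sin_gt0_pi; rewrite lt_def xm0 mx.
by rewrite sr ltxx.
Qed.

Lemma sin_pi_nat (m : nat) : sin (pi * m%:R : R) = 0.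
Proof.
have := alternatingn (@sinDpi R) m 0.
by rewrite add0r sin0 mulr0 mulr_natr.
Qed.

Definition cexp_line mu (x : R) : C :=
  (expR (Re mu * x) * cos (Im mu * x)) +i* (expR (Re mu * x) * sin (Im mu * x)).

Local Notation E := cexp_line.

Lemma cexp_line0 mu : E mu 0 = 1.
Proof. by rewrite /E !mulr0 expR0 cos0 sin0 mulr1 mulr0. Qed.

Lemma cexp_lineD mu x y : E mu (x + y) = E mu x * E mu y.
Proof.
apply: complex_ext.
  by rewrite cReM /E /= !mulrDr expRD cosD; ring.
by rewrite cImM /E /= !mulrDr expRD sinD; ring.
Qed.

Lemma CAC_cexp_line mu : CAC (E mu) (fun x => mu * E mu x).
Proof.
pose p := Re mu; pose q := Im mu.
pose fc (x : R) := expR (p * x) * cos (q * x).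
pose fs (x : R) := expR (p * x) * sin (q * x).
have Dl k (x : R) : is_derive x (1 : R) (fun y : R => k * y) k.
  have := is_derive_affine k 0 x; by under eq_fun do rewrite addr0.
have De x : is_derive x (1 : R) (fun y : R => expR (p * y)) (expR (p * x) * p).
  exact: (@is_derive1_comp R expR (fun y => p * y) x _ _ (is_derive_expR _) (Dl p x)).
have Dc x : is_derive x (1 : R) (fun y : R => cos (q * y)) (- sin (q * x) * q).
  exact: (@is_derive1_comp R cos (fun y => q * y) x _ _ (is_derive_cos _) (Dl q x)).
have Ds x : is_derive x (1 : R) (fun y : R => sin (q * y)) (cos (q * x) * q).
  exact: (@is_derive1_comp R sin (fun y => q * y) x _ _ (is_derive_sin _) (Dl q x)).
have Dfc x : is_derive x (1 : R) fc (p * fc x + - q * fs x).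
  by apply: is_derive_eq (is_derive_mul (De x) (Dc x)) _; rewrite /fc /fs; ring.
have Dfs x : is_derive x (1 : R) fs (p * fs x + q * fc x).
  by apply: is_derive_eq (is_derive_mul (De x) (Ds x)) _; rewrite /fc /fs; ring.
have cc : continuous fc by move=> x; exact: is_derive_continuous (Dfc x).
have cs : continuous fs by move=> x; exact: is_derive_continuous (Dfs x).
have clin k1 k2 (f g : R -> R) : continuous f -> continuous g ->
    continuous (fun x => k1 * f x + k2 * g x).
  by move=> fc' gc x; apply: cvgD; apply: cvgM; first [exact: cvg_cst|exact: fc'|exact: gc].
have LL := @halfpi_le R; split.
- apply: AC_eq_deriv (AC_C1 LL Dfc (clin p (- q) _ _ cc cs)) _ => x _ /=.
  by rewrite cReM /= -/p -/q -/(fc x) -/(fs x); ring.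
- apply: AC_eq_deriv (AC_C1 LL Dfs (clin p q _ _ cs cc)) _ => x _ /=.
  by rewrite cImM /= -/p -/q -/(fc x) -/(fs x); ring.
Qed.

Lemma CAC_cexp_lineN mu : CAC (fun x => E mu (- x)) (fun x => - mu * E mu (- x)).
Proof.
have EN x : E mu (- x) = E (- mu) x.
  by case: mu => p q; rewrite /E /= !mulrN !mulNr.
by apply: CAC_eq (CAC_cexp_line (- mu)) _ _ => x _ /=; rewrite EN.
Qed.

(* With [k ^+ 2 = lam], [c x = cos (k x)] and [s x = sin (k x) / k], to be read
   as [1] and [x] when [k = 0]. *)
Record fundamental lam c s : Prop := Fundamental {
  fund_dc : CAC c (fun x => - (lam * s x));
  fund_ds : CAC s c;
  fund_cD : forall x y, c (x + y) = c x * c y - lam * (s x * s y);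
  fund_sD : forall x y, s (x + y) = s x * c y + c x * s y;
  fund_cN : forall x, c (- x) = c x;
  fund_sN : forall x, s (- x) = - s x;
  fund_c0 : c 0 = 1;
  fund_zero : forall t : R, 0 < t -> lam != 0 ->
    s t = 0 <-> exists2 m : nat, (0 < m)%N & lam = ((pi * m%:R / t) ^+ 2)%:C;
  fund_lam0 : lam = 0 -> forall x, s x = x%:C
}.

Lemma fundamental0 : fundamental 0 (fun=> 1) (fun x => x%:C).
Proof.
split=> //.
- by apply: CAC_eq (CAC_cst 1) _ _ => x _ //; rewrite mul0r oppr0.
- apply: CAC_eq (CAC_affine 0 1) _ _ => x _ //.
  by rewrite mul1r add0r.
- by move=> x y; rewrite mul0r subr0 mulr1.
- by move=> x y; rewrite mulr1 mul1r rmorphD.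
- by move=> x; rewrite rmorphN.
- by move=> t _; rewrite eqxx.
Qed.

Lemma cexp_line_even mu (t : R) : t != 0 ->
  E mu t = E mu (- t) <-> Re mu = 0 /\ sin (Im mu * t) = 0.
Proof.
move=> t0; split; last first.
  by move=> [p0 s0]; rewrite /E p0 !mul0r mulrN cosN sinN s0 oppr0.
rewrite /E => -[]; rewrite !mulrN cosN sinN => Ec Es.
have s0 : sin (Im mu * t) = 0.
  have : (expR (Re mu * t) + expR (- (Re mu * t))) * sin (Im mu * t) = 0.
    by rewrite mulrDl Es mulrN addNr.
  by move/eqP; rewrite mulf_eq0 gt_eqF ?addr_gt0 ?expR_gt0//= => /eqP.
split=> //.
have c0 : cos (Im mu * t) != 0.
  apply/eqP => c0; have := cos2Dsin2 (Im mu * t).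
  by rewrite c0 s0 !expr0n/= addr0 => /esym/eqP; rewrite oner_eq0.
have /expR_inj := mulIf c0 Ec.
move/eqP; rewrite -subr_eq0 opprK -mulr2n mulrn_eq0/= mulf_eq0 (negbTE t0) orbF.
by move/eqP.
Qed.

Lemma sqr_complex_neg mu (b : R) : mu ^+ 2 = - (b ^+ 2)%:C -> b != 0 ->
  Re mu = 0 /\ Im mu ^+ 2 = b ^+ 2.
Proof.
case: mu => p q; rewrite expr2 => -[/= H1 H2] b0.
have pq : p * q = 0 by move: H2; rewrite oppr0 => H2; lra.
have [q0|q0] := eqVneq q 0.
  have : 0 < b ^+ 2 by rewrite exprn_even_gt0.
  have := sqr_ge0 p; rewrite q0 mulr0 subr0 -expr2 in H1 *; lra.
move/eqP: pq; rewrite mulf_eq0 (negbTE q0) orbF => /eqP p0; split=> //.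
by move: H1; rewrite p0 mul0r sub0r -expr2 => /oppr_inj.
Qed.

Lemma fundamentalN0 lam : lam != 0 -> exists c s, fundamental lam c s.
Proof.
move=> lam0; pose mu := sqrtc (- lam).
have mu2 : mu * mu = - lam by rewrite -expr2 sqr_sqrtc.
have mu0 : mu != 0 by rewrite sqrtc_eq0 oppr_eq0.
have lamE : lam = - (mu * mu) by rewrite mu2 opprK.
have n2 : 2 != 0 :> C by rewrite pnatr_eq0.
exists (fun x => (E mu x + E mu (- x)) / 2), (fun x => (E mu x - E mu (- x)) / (2 * mu)).
have DE := CAC_cexp_line mu; have DN := CAC_cexp_lineN mu.
split.
- apply: CAC_eq (CACZ 2^-1 (CACD DE DN)) _ _ => x _ /=; first by rewrite mulrC.
  by rewrite lamE; field.
- apply: CAC_eq (CACZ (2 * mu)^-1 (CACD DE (CACZ (-1) DN))) _ _ => x _ /=.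
    by rewrite mulN1r mulrC.
  by field.
- by move=> x y; rewrite opprD !cexp_lineD lamE; field.
- by move=> x y; rewrite opprD !cexp_lineD; field.
- by move=> x; rewrite opprK addrC.
- by move=> x; rewrite opprK -mulNr opprB.
- by rewrite oppr0 cexp_line0; field.
- move=> t t0 _; have tN0 := lt0r_neq0 t0.
  have -> : (E mu t - E mu (- t)) / (2 * mu) = 0 <-> Re mu = 0 /\ sin (Im mu * t) = 0.
    rewrite -cexp_line_even//; split=> [/eqP|->]; last by rewrite subrr mul0r.
    by rewrite mulf_eq0 invr_eq0 mulf_eq0 (negbTE n2) (negbTE mu0)/= orbF subr_eq0 => /eqP.
  have lamR : Re mu = 0 -> lam = (Im mu ^+ 2)%:C.
    move=> p0; rewrite lamE; apply: complex_ext.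
      by rewrite cReN cReM p0 /= mul0r add0r mulN1r opprK expr2.
    by rewrite cImN cImM p0 /= mul0r mulr0 addr0 oppr0.
  split.
    move=> [p0 s0]; have {}lamR := lamR p0.
    have s1 : sin (`|Im mu| * t) = 0.
      by have [_|_] := ler0P (Im mu); rewrite // mulNr sinN s0 oppr0.
    have [|m mE] := sin_zero _ s1; first by rewrite mulr_ge0 ?normr_ge0 ?ltW.
    exists m.
      rewrite lt0n; apply/eqP => m0; move: mE; rewrite m0 mulr0 => /eqP.
      rewrite mulf_eq0 (negbTE tN0) orbF normr_eq0 => /eqP q0.
      by move/eqP: lam0; apply; rewrite lamR q0 expr0n.
    by rewrite lamR -mE mulfK// real_normK ?num_real.
  move=> [m m0 lm]; have b0 : pi * m%:R / t != 0.
    by rewrite !mulf_neq0 ?invr_eq0// ?pnatr_eq0 -?lt0n// lt0r_neq0 ?pi_gt0.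
  have [|p0 q2] := @sqr_complex_neg mu (pi * m%:R / t) _ b0.
    by rewrite expr2 mu2 lm.
  split=> //; move/eqP: q2; rewrite eqf_sqr => /orP[/eqP->|/eqP->].
    by rewrite divfK// sin_pi_nat.
  by rewrite mulNr divfK// sinN sin_pi_nat oppr0.
- by move=> l0; rewrite l0 eqxx in lam0.
Qed.

Lemma fundamental_exists lam : exists c s, fundamental lam c s.
Proof.
have [->|] := eqVneq lam 0; last exact: fundamentalN0.
by exists (fun=> 1), (fun x => x%:C); exact: fundamental0.
Qed.

End FundamentalSolutions.

Section GeneralizedKernels.
Context {R : realType}.
Local Notation L := (pi / 2 : R).
Local Notation leb := (@lebesgue_measure R).
Local Notation mu := (@muI R).
Local Notation II := ([set` `[(- L)%R, L]] : set R).
Local Notation Re := (@complex.Re R).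
Local Notation Im := (@complex.Im R).
Local Notation C := (R[i]).

Lemma continuous_ae0 (F : R -> R) : {within `[- L, L], continuous F} ->
  ae_eq leb II F (fun=> 0) -> {in `[- L, L], F =1 fun=> 0}.
Proof.
move=> Fc [A [mA A0 FA]] x xL; apply/eqP; rewrite -normr_le0.
apply/ler_addgt0Pr => e e0; rewrite add0r.
have /subspace_continuousP/(_ x xL)/cvgrPdist_le/(_ e e0) := Fc.
rewrite near_withinE => -[d /= d0 H].
have L0 := @halfpi_gt0 R; have /andP[Lx xL'] : (- L <= x) && (x <= L).
  by move: xL; rewrite in_itv.
suff [y [xy yL Fy]] : exists y, [/\ `|x - y| < d, y \in `[- L, L] & F y = 0].
  by have /= := H y xy yL; rewrite [X in _ - X]Fy subr0.
apply: contrapT => nex.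
pose lo := Num.max (- L) (x - d); pose hi := Num.min L (x + d).
have lohi : lo < hi by rewrite /lo /hi lt_min !gt_max; apply/andP; split; apply/andP; split; lra.
have sub : `]lo, hi[%classic `<=` A.
  move=> y /=; rewrite in_itv/= /lo /hi lt_min gt_max => /andP[/andP[Ly dy] /andP[yL yd]].
  apply: FA => /= Fy; apply: nex; exists y.
  have yI : y \in `[- L, L] by rewrite in_itv/= !ltW.
  by split=> //; [rewrite ltr_norml; apply/andP; split; lra|exact: Fy].
have : (leb `]lo, hi[%classic <= leb A)%E by apply: le_measure; rewrite ?inE.
by rewrite A0 lebesgue_measure_itv/= lte_fin lohi -EFinD lee_fin; lra.
Qed.

Lemma CAC_ae0 F f : CAC F f -> ae_eq leb II F (fun=> 0 : C) -> {in `[- L, L], F =1 fun=> 0}.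
Proof.
move=> /CAC_continuous[rc ic] F0 x xL; apply: complex_ext.
- by apply: (continuous_ae0 rc _ xL); exact: (ae_eq_comp Re F0).
- by apply: (continuous_ae0 ic _ xL); exact: (ae_eq_comp Im F0).
Qed.

Lemma CAC_id : CAC (fun x : R => x%:C) (fun=> 1).
Proof. by apply: CAC_eq (CAC_affine 0 1) _ _ => x _ //; rewrite mul1r add0r. Qed.

Lemma CACB F G (f g : R -> C) : CAC F f -> CAC G g ->
  CAC (fun x => F x - G x) (fun x => f x - g x).
Proof.
move=> Ff Gg; apply: CAC_eq (CACD Ff (CACZ (-1) Gg)) _ _ => x _ /=;
by rewrite mulN1r.
Qed.

Variables (a : R) (ha : -1 < a < 1) (lam : C) (c s : R -> C).
Hypothesis fund : fundamental lam c s.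
Local Notation p := (L * a).

Lemma fund_pyth x : c x * c x + lam * (s x * s x) = 1.
Proof.
have := fund_cD fund x (- x).
by rewrite subrr (fund_c0 fund) (fund_cN fund) (fund_sN fund) => ->; ring.
Qed.

Lemma fund_s0 : s 0 = 0.
Proof.
have := fund_sN fund 0; rewrite oppr0 => /eqP.
by rewrite -subr_eq0 opprK -mulr2n mulrn_eq0/= => /eqP.
Qed.

Definition bdry (u : R -> C) := u (- L) = u p /\ u p = u L.

(* [sol u h]: [u] satisfies [-u'' - lam u = h] almost everywhere on the interval. *)
Definition sol (u h : R -> C) :=
  exists2 v, CAC u v & CAC v (fun x => - (lam * u x + h x)).

Lemma sol_homogeneous u : sol u (fun=> 0) ->
  exists al be : C, {in `[- L, L], forall x, u x = al * c x + be * s x}.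
Proof.
move=> [v uv vu].
pose W1 x := u x * c x - v x * s x; pose W2 x := lam * (u x * s x) + v x * c x.
have dc := fund_dc fund; have ds := fund_ds fund.
have W1E x : x \in `[- L, L] -> W1 x = W1 (- L).
  move=> xL; apply: (@CAC0_cst _ W1 x) => //.
  by apply: CAC_eq (CACB (CACM uv dc) (CACM vu ds)) _ _ => y _ //; ring.
have W2E x : x \in `[- L, L] -> W2 x = W2 (- L).
  move=> xL; apply: (@CAC0_cst _ W2 x) => //.
  by apply: CAC_eq (CACD (CACZ lam (CACM uv ds)) (CACM vu dc)) _ _ => y _ //; ring.
exists (W1 (- L)), (W2 (- L)) => x xL; rewrite -(W1E x xL) -(W2E x xL) /W1 /W2.
by rewrite -[LHS]mulr1 -(fund_pyth x); ring.
Qed.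

Lemma sol_general u up h : sol u h -> sol up h ->
  exists al be : C, {in `[- L, L], forall x, u x = up x + (al * c x + be * s x)}.
Proof.
move=> [v uv vu] [vp uvp vup].
have [|al [be H]] := @sol_homogeneous (fun x => u x - up x).
  exists (fun x => v x - vp x); first exact: CACB.
  by apply: CAC_eq (CACB vu vup) _ _ => x _ //; ring.
by exists al, be => x xL; rewrite -H// subrKC.
Qed.

Lemma sol_eq u h h' : {in `[- L, L], h =1 h'} -> sol u h -> sol u h'.
Proof.
by move=> hh [v uv vu]; exists v => //; apply: CAC_eq vu _ _ => x xL //; rewrite hh.
Qed.

Lemma sol_comb u1 u2 h1 h2 (k1 k2 : C) : sol u1 h1 -> sol u2 h2 ->
  sol (fun x => k1 * u1 x + k2 * u2 x) (fun x => k1 * h1 x + k2 * h2 x).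
Proof.
move=> [v1 uv1 vu1] [v2 uv2 vu2].
exists (fun x => k1 * v1 x + k2 * v2 x); first exact: CACD (CACZ _ uv1) (CACZ _ uv2).
by apply: CAC_eq (CACD (CACZ k1 vu1) (CACZ k2 vu2)) _ _ => x _ //; ring.
Qed.

Lemma sol_c : sol c (fun=> 0).
Proof.
exists (fun x => - (lam * s x)); first exact: fund_dc fund.
by apply: CAC_eq (CACZ (- lam) (fund_ds fund)) _ _ => x _ //; ring.
Qed.

Lemma sol_s : sol s (fun=> 0).
Proof.
exists c; first exact: fund_ds fund.
by apply: CAC_eq (fund_dc fund) _ _ => x _ //; ring.
Qed.

Lemma sol_xs : sol (fun x => x%:C * s x) (fun x => - 2 * c x).
Proof.
have dc := fund_dc fund; have ds := fund_ds fund.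
exists (fun x => s x + x%:C * c x).
  by apply: CAC_eq (CACM CAC_id ds) _ _ => x _ //; ring.
by apply: CAC_eq (CACD ds (CACM CAC_id dc)) _ _ => x _ //; ring.
Qed.

Lemma sol_xc : sol (fun x => x%:C * c x) (fun x => 2 * lam * s x).
Proof.
have dc := fund_dc fund; have ds := fund_ds fund.
exists (fun x => c x - lam * (x%:C * s x)).
  by apply: CAC_eq (CACM CAC_id dc) _ _ => x _ //; ring.
by apply: CAC_eq (CACB dc (CACZ lam (CACM CAC_id ds))) _ _ => x _ //; ring.
Qed.

Lemma sol_xxc : sol (fun x => x%:C * x%:C * c x)
  (fun x => - 2 * c x + 4 * lam * (x%:C * s x)).
Proof.
have dc := fund_dc fund; have ds := fund_ds fund.
have dxx := CACM CAC_id CAC_id.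
exists (fun x => 2 * (x%:C * c x) - lam * (x%:C * x%:C * s x)).
  by apply: CAC_eq (CACM dxx dc) _ _ => x _ //; ring.
by apply: CAC_eq (CACB (CACZ 2 (CACM CAC_id dc)) (CACZ lam (CACM dxx ds))) _ _ => x _ //; ring.
Qed.

(* [- x s / 2], [x c / (2 lam)] and [(x^2 c - x s) / (4 lam)] are preimages of
   [c], [s] and [x s] under [- d^2/dx^2 - lam]. *)
Lemma sol_resonant (al be ga : C) : lam != 0 ->
  sol (fun x => - (al / 2) * (x%:C * s x) + be / (2 * lam) * (x%:C * c x)
      + ga / (4 * lam) * (x%:C * x%:C * c x - x%:C * s x))
    (fun x => al * c x + be * s x + ga * (x%:C * s x)).
Proof.
move=> lam0.
have n2 : 2 != 0 :> C by rewrite pnatr_eq0.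
have n4 : 4 != 0 :> C by rewrite pnatr_eq0.
have [v uv vu] := sol_comb 1 1 (sol_comb (- (al / 2)) (be / (2 * lam)) sol_xs sol_xc)
  (sol_comb (ga / (4 * lam)) (- (ga / (4 * lam))) sol_xxc sol_xs).
exists v.
  by apply: CAC_eq uv _ _ => x _ //; field.
by apply: CAC_eq vu _ _ => x _ //; field.
Qed.

Lemma opH_sol f g H : opH a f g -> Citg H ->
  ae_eq mu setT (fun x => g x - lam * f x) H ->
  exists U, [/\ sol U H, ae_eq leb II f U & bdry U].
Proof.
move=> /(opHP _ _ ha)[f2 g2 [U [V [UV Vg fU b1 b2]]]] Hi /ae_muI gH.
exists U; split=> //; exists V => //.
have [rU iU] : Citg U.
  exact: continuous_on_closure_itg (CAC_continuous UV).
have [rH iH] := Hi.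
apply: (CAC_ae Vg).
- have := itgD (itgD (itgZ (- Re lam) rU) (itgZ (Im lam) iU)) (itgZ (-1) rH).
  move=> /itg_mem_measurable; apply: eq_measurable_fun => x _ /=.
  by rewrite cReN cReD cReM; ring.
- have := itgD (itgD (itgZ (- Re lam) iU) (itgZ (- Im lam) rU)) (itgZ (-1) iH).
  move=> /itg_mem_measurable; apply: eq_measurable_fun => x _ /=.
  by rewrite cImN cImD cImM; ring.
apply: filterS2 gH fU => x /= E1 E2 xL.
by rewrite -(E1 xL) -(E2 xL) subrKC.
Qed.

Lemma sol_ker_pow U H H' n : sol U H -> CAC H H' -> bdry U ->
  ker_pow mu (opH a) lam n (patchI H) -> ker_pow mu (opH a) lam n.+1 (patchI U).
Proof.
move=> [V UV VU] HH [b1 b2] kH.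
exists (patchI (fun x => lam * U x + H x)).
  apply/(opHP _ _ ha); split; first exact: CAC_cL2 UV.
    exact: (CAC_cL2 (CACD (CACZ lam UV) HH)).
  exists U, V; split=> //.
    by apply: CAC_eq VU _ _ => x xL //; rewrite patchIE.
  by apply/aeW => x xL; rewrite patchIE.
have E : (fun x => patchI (fun x => lam * U x + H x) x - lam * patchI U x) = patchI H.
  by apply/funext => x; rewrite /patchI; case: ifP => _; ring.
by move: kH; rewrite -E.
Qed.

Lemma patchI0 : patchI (fun=> 0) = (fun=> 0 : C).
Proof. by apply/funext => x; rewrite /patchI; case: ifP. Qed.

Lemma cL2_0 : cL2 mu (fun=> 0).
Proof. by rewrite -patchI0; exact: CAC_cL2 (CAC_cst 0). Qed.

Lemma ker_pow0_patch0 : ker_pow mu (opH a) lam 0 (patchI (fun=> 0)).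
Proof. by rewrite patchI0; split; [exact: cL2_0|exact: ae_eq_refl]. Qed.

Lemma sol_ker1 U : sol U (fun=> 0) -> bdry U -> ker_pow mu (opH a) lam 1 (patchI U).
Proof.
by move=> sU bU; apply: sol_ker_pow sU (CAC_cst 0) bU ker_pow0_patch0.
Qed.

End GeneralizedKernels.

Section Multiplicities.
Context {R : realType}.
Local Notation L := (pi / 2 : R).
Local Notation leb := (@lebesgue_measure R).
Local Notation mu := (@muI R).
Local Notation II := ([set` `[(- L)%R, L]] : set R).
Local Notation C := (R[i]).
Variables (a : R) (ha : -1 < a < 1) (lam : C) (c s : R -> C).
Hypothesis fund : fundamental lam c s.
Local Notation p := (L * a).
Local Notation kerP := (ker_pow mu (opH a) lam).

Let pL : p \in `[- L, L] := subset_itv_oo_cc (halfpi_in ha).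
Let LL := @mem_halfpi R.
Let NL := @memNhalfpi R.

Lemma ae_patchI (F : R -> C) : ae_eq leb II (patchI F) F.
Proof. by apply/aeW => x xL; rewrite patchIE. Qed.

Lemma ker_pow0_ae f : kerP 0 f -> ae_eq leb II f (fun=> 0).
Proof. by case=> _ /ae_muI. Qed.

Lemma sol_CAC u h : sol lam u h -> exists v, CAC u v.
Proof. by case=> v uv _; exists v. Qed.

Lemma simple_multiplicity (psi : R -> C) (x0 : R) :
  sol lam psi (fun=> 0) -> bdry a psi -> x0 \in `[- L, L] -> psi x0 != 0 ->
  (forall U k, sol lam U (fun x => k * psi x) -> bdry a U ->
    exists k', {in `[- L, L], forall x, U x = k' * psi x}) ->
  op_eigenvalue mu (opH a) lam /\ algebraic_multiplicity mu (opH a) lam 1.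
Proof.
move=> spsi bpsi x0L psi0 Hpsi; have [psi' dpsi] := sol_CAC spsi.
have kpsi : kerP 1 (patchI psi) by exact: sol_ker1.
have nz k : ae_eq leb II (fun x => k * psi x) (fun=> 0) -> k = 0.
  move=> /(CAC_ae0 (CACZ k dpsi)) /(_ x0 x0L) /eqP.
  by rewrite mulf_eq0 (negbTE psi0) orbF => /eqP.
have ker n f : kerP n f -> exists k, ae_eq leb II f (fun x => k * psi x).
  elim: n f => [f /ker_pow0_ae f0|n IH f [g Afg /IH [k gk]]].
    by exists 0; apply: filterS f0 => x /[apply] ->; rewrite mul0r.
  have ki := continuous_on_closure_itg (CAC_continuous (CACZ k dpsi)).
  have [U [sU fU bU]] := opH_sol ha Afg ki ((ae_muI _ _).2 gk).
  have [k' Uk] := Hpsi U k sU bU.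
  by exists k'; apply: filterS fU => x /= fx xL; rewrite fx// Uk.
split.
  exists (patchI psi) => // /ae_muI psi_ae; have := oner_neq0 C.
  rewrite (nz 1) ?eqxx//; apply: filterS psi_ae => x /= + xL.
  by rewrite patchIE// mul1r; apply.
exists (fun=> patchI psi); split.
- by move=> _; exists 1%N.
- move=> k /ae_muI k0 i; rewrite ord1; apply: nz.
  apply: filterS k0 => x /= + xL; rewrite big_ord1 patchIE//; exact.
- move=> f [n _ /ker [k fk]]; exists (fun=> k); apply/ae_muI.
  by apply: filterS fk => x /= fx xL; rewrite big_ord1 fx// patchIE.
Qed.

Lemma fund_cNL : c (- L) = c L. Proof. exact: fund_cN fund L. Qed.
Lemma fund_sNL : s (- L) = - s L. Proof. exact: fund_sN fund L. Qed.

Let n2 : 2 != 0 :> C. Proof. by rewrite pnatr_eq0. Qed.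
Let L0 : L%:C != 0.
Proof. by rewrite -(rmorph0 (real_complex R)) (inj_eq (@complexI R)) lt0r_neq0// halfpi_gt0. Qed.

Lemma double_eq0 (z : C) : z = - z -> z = 0.
Proof.
by move/eqP; rewrite -subr_eq0 opprK -mulr2n mulrn_eq0/= => /eqP.
Qed.

Lemma eq_from (k P Q X Y : C) : P = Q -> X - Y = k * (P - Q) -> X = Y.
Proof. by move=> ->; rewrite subrr mulr0 => /eqP; rewrite subr_eq0 => /eqP. Qed.

Lemma multiplicity_even : s L != 0 -> c L = c p -> L%:C * s L != p%:C * s p ->
  op_eigenvalue mu (opH a) lam /\ algebraic_multiplicity mu (opH a) lam 1.
Proof.
move=> sL0 cLp LsL.
have bc : bdry a c by rewrite /bdry fund_cNL cLp.
apply: (simple_multiplicity (sol_c fund) bc (x0 := 0)).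
- by rewrite in_itv/= oppr_le0 ltW ?halfpi_gt0.
- by rewrite (fund_c0 fund) oner_neq0.
move=> U k sU [bU1 bU2].
have sp : sol lam (fun x => - (k / 2) * (x%:C * s x) + 0 * c x) (fun x => k * c x).
  have := sol_comb (- (k / 2)) 0 (sol_xs fund) (sol_c fund).
  by apply: sol_eq => x _; field.
have [al [be UE]] := sol_general fund sU sp.
move: bU1 bU2; rewrite !UE// fund_cNL fund_sNL rmorphN => b1 b2.
have be0 : be = 0.
  have : be * s L = 0.
    by apply/double_eq0/(eq_from (k := -1) (etrans b1 b2)); ring.
  by move/eqP; rewrite mulf_eq0 (negbTE sL0) orbF => /eqP.
have k0 : k = 0.
  have : - (k / 2) * (p%:C * s p - L%:C * s L) = 0.
    by apply: (eq_from (k := 1) b2); rewrite be0 cLp; ring.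
  move/eqP; rewrite mulf_eq0 subr_eq0 [_ * s p == _]eq_sym (negbTE LsL) orbF.
  by rewrite oppr_eq0 mulf_eq0 invr_eq0 (negbTE n2) orbF => /eqP.
exists al => x xL; rewrite UE// be0 k0; ring.
Qed.

Lemma fund_c2 x : s x = 0 -> c x * c x = 1.
Proof. by move=> sx; have := fund_pyth fund x; rewrite sx !mulr0 addr0. Qed.

Lemma fund_c_neq0 x : s x = 0 -> c x != 0.
Proof.
move=> /fund_c2 c2; apply/eqP => c0; move/eqP: c2.
by rewrite c0 mul0r eq_sym oner_eq0.
Qed.

Lemma fund_s_neq0 : exists2 x, x \in `[- L, L] & s x != 0.
Proof.
apply: contrapT => nex.
have s0 x : x \in `[- L, L] -> s x = 0.
  by move=> xL; apply/eqP/negPn/negP => px; apply: nex; exists x.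
have c0 : CAC c (fun=> 0).
  by apply: CAC_eq (fund_dc fund) _ _ => x xL //; rewrite s0// mulr0 oppr0.
have c1 x : x \in `[- L, L] -> c x = 1.
  move=> xL; rewrite (CAC0_cst c0 xL) -(fund_c0 fund) (CAC0_cst c0)//.
  by rewrite in_itv/= oppr_le0 ltW ?halfpi_gt0.
have sx : CAC (fun x => s x - x%:C) (fun=> 0).
  apply: CAC_eq (CACB (fund_ds fund) CAC_id) _ _ => x xL //.
  by rewrite c1// subrr.
have := CAC0_cst sx LL; rewrite !s0// !sub0r rmorphN => H; have /eqP := double_eq0 H.
by rewrite oppr_eq0 (negbTE L0).
Qed.

Lemma multiplicity_odd : lam != 0 -> s L = 0 -> c L != c p ->
  op_eigenvalue mu (opH a) lam /\ algebraic_multiplicity mu (opH a) lam 1.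
Proof.
move=> lam0 sL0 cLp.
have cLp0 : c L - c p != 0 by rewrite subr_eq0.
pose ka := s p / (c L - c p).
have kaE : ka * (c L - c p) = s p by rewrite /ka divfK.
pose psi x := ka * c x + 1 * s x.
have spsi : sol lam psi (fun=> 0).
  have := sol_comb ka 1 (sol_c fund) (sol_s fund).
  by apply: sol_eq => x _; ring.
have bpsi : bdry a psi.
  rewrite /bdry /psi fund_cNL fund_sNL sL0 oppr0 mulr0 addr0 mul1r -kaE.
  by split; ring.
have [x0 [x0L psi0]] : exists x0, x0 \in `[- L, L] /\ psi x0 != 0.
  apply: contrapT => nex.
  have psi0 x : x \in `[- L, L] -> psi x = 0.
    by move=> xL; apply/eqP/negPn/negP => px; apply: nex; exists x.
  have ka0 : ka = 0.
    have := psi0 L LL; rewrite /psi sL0 mulr0 addr0 => /eqP.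
    by rewrite mulf_eq0 (negbTE (fund_c_neq0 sL0)) orbF => /eqP.
  have [x xL /negP] := fund_s_neq0; apply; apply/eqP.
  by have := psi0 x xL; rewrite /psi ka0 mul0r add0r mul1r.
apply: (simple_multiplicity spsi bpsi x0L psi0).
move=> U k sU [bU1 bU2].
have sp := sol_eq _ (sol_resonant fund (k * ka) k 0 lam0).
have [|al [be UE]] := sol_general fund sU (sp (fun x => k * psi x) _).
  by move=> x _; rewrite /psi; ring.
move: bU1 bU2; rewrite !UE// fund_cNL fund_sNL rmorphN sL0 => b1 b2.
have k0 : k = 0.
  have : k / (2 * lam) * (L%:C * c L) = 0.
    by apply/double_eq0/(eq_from (k := -1) (etrans b1 b2)); field.
  move/eqP; rewrite !mulf_eq0 (negbTE L0) (negbTE (fund_c_neq0 sL0)) invr_eq0 mulf_eq0.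
  by rewrite (negbTE n2) (negbTE lam0) !orbF => /eqP.
have alE : al = be * ka.
  apply: (mulIf cLp0); rewrite -[RHS]mulrA kaE.
  by apply: (eq_from (k := -1) b2); rewrite k0; field.
by exists be => x xL; rewrite UE// k0 alE /psi; field.
Qed.

End Multiplicities.

Section TripleEigenvalue.
Context {R : realType}.
Local Notation L := (pi / 2 : R).
Local Notation leb := (@lebesgue_measure R).
Local Notation mu := (@muI R).
Local Notation II := ([set` `[(- L)%R, L]] : set R).
Local Notation C := (R[i]).
Variables (a : R) (ha : -1 < a < 1) (lam : C) (c s : R -> C).
Hypothesis fund : fundamental lam c s.
Local Notation p := (L * a).
Local Notation kerP := (ker_pow mu (opH a) lam).
Hypotheses (lam0 : lam != 0) (sL0 : s L = 0) (sp0 : s p = 0) (cLp : c L = c p).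

Let pL : p \in `[- L, L] := subset_itv_oo_cc (halfpi_in ha).
Let LL := @mem_halfpi R.
Let NL := @memNhalfpi R.
Let n2 : 2 != 0 :> C. Proof. by rewrite pnatr_eq0. Qed.
Let n4 : 4 != 0 :> C. Proof. by rewrite pnatr_eq0. Qed.

Lemma realC_eq0 (x : R) : (x%:C == 0 :> C) = (x == 0).
Proof. by rewrite -(rmorph0 (real_complex R)) (inj_eq (@complexI R)). Qed.

Let cL0 : c L != 0 := fund_c_neq0 fund sL0.

Definition comb3 (al be ga : C) x := al * c x + be * s x + ga * (x%:C * s x).

Lemma comb3_CAC al be ga : exists v, CAC (comb3 al be ga) v.
Proof.
have ds := fund_ds fund.
by eexists; apply: CACD (CACD (CACZ _ (fund_dc fund)) (CACZ _ ds)) (CACZ _ (CACM CAC_id ds)).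
Qed.

Lemma comb3_indep al be ga : ae_eq leb II (comb3 al be ga) (fun=> 0) ->
  [/\ al = 0, be = 0 & ga = 0].
Proof.
have [v dv] := comb3_CAC al be ga.
move=> /(CAC_ae0 dv) u0.
have al0 : al = 0.
  have := u0 0; rewrite in_itv/= oppr_le0 ltW ?halfpi_gt0// => /(_ isT).
  by rewrite /comb3 (fund_c0 fund) (fund_s0 fund) !mulr0 !addr0 mulr1.
have [x xL sx] := fund_s_neq0 fund.
have x0 : x%:C != 0 :> C.
  by rewrite realC_eq0; apply: contraNneq sx => ->; rewrite (fund_s0 fund).
have xL' : - x \in `[- L, L].
  by move: xL; rewrite !in_itv/= lerN2 lerNl andbC.
have E1 : be + ga * x%:C = 0.
  apply: (mulIf sx); rewrite mul0r -(u0 x xL) /comb3 al0; ring.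
have E2 : be - ga * x%:C = 0.
  have := u0 (- x) xL'; rewrite /comb3 al0 (fund_sN fund) rmorphN => E.
  by apply: (mulIf sx); apply: (eq_from (k := -1) E); ring.
have be0 : be = 0.
  apply: (mulfI n2); rewrite mulr0 -(addr0 0) -{1}E1 -E2; ring.
split=> //; move/eqP: E1; rewrite be0 add0r mulf_eq0 (negbTE x0) orbF.
by move/eqP.
Qed.

Lemma triple_step al be ga U : sol lam U (comb3 al be ga) -> bdry a U ->
  [/\ be = 0, ga = 0 & exists al' be',
    {in `[- L, L], U =1 comb3 al' be' (- (al / 2))}].
Proof.
move=> sU [bU1 bU2].
have [al' [be' UE]] := sol_general fund sU (sol_resonant fund al be ga lam0).
move: bU1 bU2; rewrite !UE// (fund_cNL fund) (fund_sNL fund) rmorphN sL0 sp0 -cLp => b1 b2.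
have L0 : L%:C != 0 :> C by rewrite realC_eq0 lt0r_neq0// halfpi_gt0.
have be0 : be = 0.
  have : be / (2 * lam) * (L%:C * c L) = 0.
    by apply/double_eq0/(eq_from (k := -1) (etrans b1 b2)); field.
  move/eqP; rewrite !mulf_eq0 (negbTE L0) (negbTE cL0) invr_eq0 mulf_eq0.
  by rewrite (negbTE n2) (negbTE lam0) !orbF => /eqP.
have ga0 : ga = 0.
  have : ga / (4 * lam) * ((L%:C * L%:C - p%:C * p%:C) * c L) = 0.
    by apply: (eq_from (k := -1) b2); rewrite be0; field.
  have pL2 : L%:C * L%:C - p%:C * p%:C != 0 :> C.
    rewrite -!rmorphM -rmorphB realC_eq0.
    have -> : L * L - p * p = L * L * ((1 - a) * (1 + a)) by ring.
    have /andP[a1 a2] := ha.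
    have hp := @halfpi_gt0 R; apply/lt0r_neq0/mulr_gt0; first exact: mulr_gt0.
    by apply: mulr_gt0; lra.
  move/eqP; rewrite !mulf_eq0 (negbTE pL2) (negbTE cL0) invr_eq0 mulf_eq0.
  by rewrite (negbTE n4) (negbTE lam0) !orbF => /eqP.
split=> //; exists al', be' => x xL.
by rewrite UE// be0 ga0 /comb3; field.
Qed.

Lemma triple_ker n f : kerP n f -> exists al be ga, ae_eq leb II f (comb3 al be ga).
Proof.
elim: n f => [f /ker_pow0_ae f0|n IH f [g Afg /IH [al [be [ga gk]]]]].
  by exists 0, 0, 0; apply: filterS f0 => x /[apply] ->; rewrite /comb3 !mul0r !addr0.
have [v dv] := comb3_CAC al be ga.
have ki := continuous_on_closure_itg (CAC_continuous dv).
have [U [sU fU bU]] := opH_sol ha Afg ki ((ae_muI _ _).2 gk).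
have [_ _ [al' [be' UE]]] := triple_step sU bU.
by exists al', be', (- (al / 2)); apply: filterS fU => x /= fx xL; rewrite fx// UE.
Qed.

Lemma triple_ker1 f : kerP 1 f -> exists al be, ae_eq leb II f (comb3 al be 0).
Proof.
move=> [g Afg [_ /ae_muI g0]].
have ki : Citg (comb3 0 0 0).
  have [v dv] := comb3_CAC 0 0 0.
  exact: continuous_on_closure_itg (CAC_continuous dv).
have gk : ae_eq leb II (fun x => g x - lam * f x) (comb3 0 0 0).
  rewrite (_ : comb3 0 0 0 = fun=> 0); first exact: g0.
  by apply/funext => x; rewrite /comb3 !mul0r !addr0.
have [U [sU fU bU]] := opH_sol ha Afg ki ((ae_muI _ _).2 gk).
have [_ _ [al' [be' UE]]] := triple_step sU bU.
exists al', be'; apply: filterS fU => x /= fx xL.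
by rewrite fx// UE// mul0r oppr0.
Qed.

Lemma triple_ker_c : kerP 1 (patchI c).
Proof.
apply: (sol_ker1 ha (sol_c fund)).
by rewrite /bdry (fund_cNL fund) cLp.
Qed.

Lemma triple_ker_s : kerP 1 (patchI s).
Proof.
apply: (sol_ker1 ha (sol_s fund)).
by rewrite /bdry (fund_sNL fund) sL0 sp0 oppr0.
Qed.

Lemma triple_ker_xs : kerP 2 (patchI (fun x => x%:C * s x)).
Proof.
apply: (sol_ker_pow ha (sol_xs fund) (CACZ (-2) (fund_dc fund))).
- by rewrite /bdry (fund_sNL fund) sL0 sp0 oppr0 !mulr0.
apply: (sol_ker1 ha).
  have := sol_comb (-2) 0 (sol_c fund) (sol_c fund).
  by case=> v uv vu; exists v; [apply: CAC_eq uv _ _|apply: CAC_eq vu _ _] => x _ //; ring.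
by rewrite /bdry (fund_cNL fund) cLp.
Qed.

Lemma triple_multiplicity : [/\ op_eigenvalue mu (opH a) lam,
  geometric_multiplicity mu (opH a) lam 2 & algebraic_multiplicity mu (opH a) lam 3].
Proof.
pose basis (i : nat) := patchI (nth c [:: c; s; fun x => x%:C * s x] i).
have sum3 (k : 'I_3 -> C) x : x \in `[- L, L] ->
    \sum_(i < 3) k i * basis i x = comb3 (k (inord 0)) (k (inord 1)) (k (inord 2)) x.
  move=> xL; rewrite !big_ord_recl big_ord0 addr0 /basis /= !patchIE// addrA.
  by congr (k _ * _ + k _ * _ + k _ * _); apply/val_inj; rewrite /= inordK.
have sum2 (k : 'I_2 -> C) x : x \in `[- L, L] ->
    \sum_(i < 2) k i * basis i x = comb3 (k (inord 0)) (k (inord 1)) 0 x.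
  move=> xL; rewrite !big_ord_recl big_ord0 addr0 /basis /= !patchIE// /comb3 mul0r addr0.
  by congr (k _ * _ + k _ * _); apply/val_inj; rewrite /= inordK.
split.
- exists (patchI c); first exact: triple_ker_c.
  move=> /ae_muI c0; have := oner_neq0 C.
  have [|-> _ _] := @comb3_indep 1 0 0; last by rewrite eqxx.
  apply: filterS c0 => x /= + xL; rewrite patchIE// /comb3 => -> //; ring.
- exists (fun i => basis i); split.
  + by case=> [[|[|i]]] //= _; [exact: triple_ker_c|exact: triple_ker_s].
  + move=> k /ae_muI k0.
    have [|k0' k1' _] := @comb3_indep (k (inord 0)) (k (inord 1)) 0.
      by apply: filterS k0 => x /= + xL; rewrite -sum2//; apply.
    case=> [[|[|i]]] //= i2; [rewrite -[RHS]k0'|rewrite -[RHS]k1'];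
    by congr k; apply/val_inj; rewrite /= inordK.
  + move=> f /triple_ker1[al [be fE]]; exists (fun i : 'I_2 => nth 0 [:: al; be] i).
    apply/ae_muI; apply: filterS fE => x /= fx xL.
    by rewrite sum2// !inordK//= fx.
- exists (fun i => basis i); split.
  + case=> [[|[|[|i]]]] //= _.
    * by exists 1%N => //; exact: triple_ker_c.
    * by exists 1%N => //; exact: triple_ker_s.
    * by exists 2%N => //; exact: triple_ker_xs.
  + move=> k /ae_muI k0.
    have [|k0' k1' k2'] := @comb3_indep (k (inord 0)) (k (inord 1)) (k (inord 2)).
      by apply: filterS k0 => x /= + xL; rewrite -sum3//; apply.
    case=> [[|[|[|i]]]] //= i2; [rewrite -[RHS]k0'|rewrite -[RHS]k1'|rewrite -[RHS]k2'];
    by congr k; apply/val_inj; rewrite /= inordK.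
  + move=> f [n _ /triple_ker[al [be [ga fE]]]].
    exists (fun i : 'I_3 => nth 0 [:: al; be; ga] i).
    apply/ae_muI; apply: filterS fE => x /= fx xL.
    by rewrite sum3// !inordK//= fx.
Qed.

End TripleEigenvalue.

Section Resolvent.
Context {R : realType}.
Local Notation L := (pi / 2 : R).
Local Notation Re := (@complex.Re R).
Local Notation Im := (@complex.Im R).
Local Notation C := (R[i]).
Local Notation normc := (@Normc.normc R).

Lemma normcE_sqrt (z : C) : normc z = Num.sqrt (Re z ^+ 2 + Im z ^+ 2).
Proof. by case: z. Qed.

Lemma normc_ge0 (z : C) : 0 <= normc z.
Proof. by rewrite normcE_sqrt sqrtr_ge0. Qed.

Lemma Re_le_normc (z : C) : `|Re z| <= normc z.
Proof. by rewrite normcE_sqrt -sqrtr_sqr ler_wsqrtr// lerDl sqr_ge0. Qed.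

Lemma Im_le_normc (z : C) : `|Im z| <= normc z.
Proof. by rewrite normcE_sqrt -sqrtr_sqr ler_wsqrtr// lerDr sqr_ge0. Qed.

Definition norm1 (z : C) : R := `|Re z| + `|Im z|.

Lemma normc_le_norm1 (z : C) : normc z <= norm1 z.
Proof.
rewrite normcE_sqrt -[leRHS]ger0_norm; last by rewrite addr_ge0.
rewrite -sqrtr_sqr ler_wsqrtr// sqrrD !real_normK ?num_real//.
by rewrite addrAC lerDl mulrn_wge0// mulr_ge0.
Qed.

Lemma norm1_le_normc (z : C) : norm1 z <= 2 * normc z.
Proof. by rewrite mulr_natl mulr2n lerD ?Re_le_normc ?Im_le_normc. Qed.

Lemma normc_triangle (z w : C) : normc (z + w) <= normc z + normc w.
Proof. exact: le_normcD. Qed.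

Lemma itg_norm1 f : Citg f -> itg (- L) L (norm1 \o f).
Proof.
move=> [rf mf]; apply: itgD.
- by have := integrable_norm rf; apply: eq_integrable.
- by have := integrable_norm mf; apply: eq_integrable.
Qed.

Lemma prim_norm_le (f g : R -> R) x : itg (- L) L f -> itg (- L) L g ->
  (forall y, y \in `[- L, L] -> `|f y| <= g y) -> x \in `[- L, L] ->
  `|prim (- L) f x| <= prim (- L) g L.
Proof.
move=> fi gi fg xL; have [Lx xL'] : - L <= x /\ x <= L by move: xL; rewrite in_itv => /andP.
have sub y : y \in `[- L, x] -> y \in `[- L, L].
  by rewrite !in_itv/= => /andP[-> /le_trans]; exact.
have fix_ := itg_sub fi xL; have gix := itg_sub gi xL.
apply: le_trans (le_normr_Rintegral _ fix_) _ => //.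
apply: (@le_trans _ _ (prim (- L) g x)).
  apply: le_Rintegral => //; first by have := integrable_norm fix_; apply: eq_integrable.
  by move=> y /sub; exact: fg.
rewrite -subr_ge0 /prim Rintegral_itvB ?bnd_simp//.
apply: Rintegral_ge0 => y /=; rewrite in_itv/= => /andP[xy yL].
apply: le_trans (normr_ge0 _) (fg y _).
by rewrite in_itv/= yL (le_trans Lx)// ltW.
Qed.

Lemma Cprim_norm_le (f : R -> C) (g : R -> R) x : Citg f -> itg (- L) L g ->
  (forall y, y \in `[- L, L] -> normc (f y) <= g y) -> x \in `[- L, L] ->
  normc (Cprim f x) <= 2 * prim (- L) g L.
Proof.
move=> [rf mf] gi fg xL; apply: le_trans (normc_le_norm1 _) _.
rewrite mulr_natl mulr2n; apply: lerD; apply: prim_norm_le => // y /fg;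
by apply: le_trans; rewrite ?Re_le_normc ?Im_le_normc.
Qed.

Lemma continuous_normc_bounded (F : R -> C) : continuous_on_closure F ->
  exists2 M, 0 <= M & forall x, x \in `[- L, L] -> normc (F x) <= M.
Proof.
move=> [/within_continuous_bounded[M1 [_ B1]] /within_continuous_bounded[M2 [_ B2]]].
have H x : x \in `[- L, L] -> normc (F x) <= (M1 + 1) + (M2 + 1).
  move=> xL; apply: le_trans (normc_le_norm1 _) _; apply: lerD.
  - by apply: (B1 (M1 + 1)); [rewrite ltrDl|exact: xL].
  - by apply: (B2 (M2 + 1)); [rewrite ltrDl|exact: xL].
exists ((M1 + 1) + (M2 + 1)) => //.
exact: le_trans (normc_ge0 _) (H _ (@mem_halfpi R)).
Qed.

Lemma Citg_mul (F h : R -> C) : continuous_on_closure F -> Citg h ->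
  Citg (fun x => F x * h x).
Proof.
move=> [rF iF] [rh ih]; split.
- have := itgD (itgM_continuous rF rh) (itgZ (-1) (itgM_continuous iF ih)).
  by apply: eq_integrable => // x _ /=; rewrite cReM.
- have := itgD (itgM_continuous rF ih) (itgM_continuous iF rh).
  by apply: eq_integrable => // x _ /=; rewrite cImM.
Qed.

Variables (a : R) (ha : -1 < a < 1) (lam : C) (c s : R -> C).
Hypothesis fund : fundamental lam c s.
Local Notation p := (L * a).
Hypotheses (sL0 : s L != 0) (cLp : c L != c p).

Let pL : p \in `[- L, L] := subset_itv_oo_cc (halfpi_in ha).
Let LL := @mem_halfpi R.
Let NL := @memNhalfpi R.

Definition duhamel (h : R -> C) (x : R) : C :=
  c x * Cprim (fun y => s y * h y) x - s x * Cprim (fun y => c y * h y) x.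

Lemma sol_duhamel h : Citg h -> sol lam (duhamel h) h.
Proof.
move=> hi; have dc := fund_dc fund; have ds := fund_ds fund.
have dQ := CAC_Cprim (Citg_mul (CAC_continuous ds) hi).
have dP := CAC_Cprim (Citg_mul (CAC_continuous dc) hi).
exists (fun x => - (lam * s x) * Cprim (fun y => s y * h y) x - c x * Cprim (fun y => c y * h y) x).
  apply: CAC_eq (CACB (CACM dc dQ) (CACM ds dP)) _ _ => x _ //; ring.
apply: CAC_eq (CACB (CACM (CACZ (- lam) ds) dQ) (CACM dc dP)) _ _ => x _ //.
  by ring.
rewrite /duhamel -[h x in RHS]mul1r -(fund_pyth fund x); ring.
Qed.

Definition coef_s h : C := - duhamel h L / (2 * s L).
Definition coef_c h : C :=
  (duhamel h p - duhamel h L - coef_s h * (s L - s p)) / (c L - c p).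

Lemma duhamelNL h : duhamel h (- L) = 0.
Proof. by rewrite /duhamel !Cprim0 !mulr0 subrr. Qed.

Let n2 : 2 != 0 :> C. Proof. by rewrite pnatr_eq0. Qed.
Let cLp0 : c L - c p != 0. Proof. by rewrite subr_eq0. Qed.

Lemma bdry_resolvent h : bdry a (fun x => duhamel h x + (coef_c h * c x + coef_s h * s x)).
Proof.
rewrite /bdry duhamelNL (fund_cNL fund) (fund_sNL fund).
have Ec : coef_c h * (c L - c p) = duhamel h p - duhamel h L - coef_s h * (s L - s p).
  by rewrite /coef_c divfK.
have Es : 2 * (coef_s h * s L) = - duhamel h L.
  by rewrite /coef_s; field.
have E2 : duhamel h p + (coef_c h * c p + coef_s h * s p) =
    duhamel h L + (coef_c h * c L + coef_s h * s L).
  by apply: (eq_from (k := -1) Ec); ring.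
split=> //; rewrite E2; apply: (eq_from (k := -1) Es); ring.
Qed.

Lemma sol_bdry_unique U h : Citg h -> sol lam U h -> bdry a U ->
  {in `[- L, L], forall x, U x = duhamel h x + (coef_c h * c x + coef_s h * s x)}.
Proof.
move=> hi sU [bU1 bU2].
have [al [be UE]] := sol_general fund sU (sol_duhamel hi).
move: bU1 bU2; rewrite !UE// duhamelNL (fund_cNL fund) (fund_sNL fund) => b1 b2.
have beE : be = coef_s h.
  have E : 2 * (be * s L) = - duhamel h L.
    by apply: (eq_from (k := -1) (etrans b1 b2)); ring.
  by rewrite /coef_s -E; field.
have alE : al = coef_c h.
  rewrite /coef_c -beE; apply: (mulIf cLp0); rewrite divfK//.
  by apply: (eq_from (k := -1) b2); ring.
by move=> x xL; rewrite UE// beE alE.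
Qed.

Lemma duhamel_bound : exists2 K, 0 <= K & forall h x, Citg h -> x \in `[- L, L] ->
  normc (duhamel h x) <= K * prim (- L) (norm1 \o h) L.
Proof.
have dc := fund_dc fund; have ds := fund_ds fund.
have [M1 M10 B1] := continuous_normc_bounded (CAC_continuous dc).
have [M2 M20 B2] := continuous_normc_bounded (CAC_continuous ds).
exists (M1 * (2 * M2) + M2 * (2 * M1)) => [|h x hi xL].
  by rewrite addr_ge0// !mulr_ge0.
have ni := itg_norm1 hi.
have bd (F : R -> C) M : continuous_on_closure F -> 0 <= M ->
    (forall y, y \in `[- L, L] -> normc (F y) <= M) ->
    normc (Cprim (fun y => F y * h y) x) <= 2 * M * prim (- L) (norm1 \o h) L.
  move=> Fc M0 FM; rewrite -mulrA -(primZ M ni LL).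
  apply: Cprim_norm_le => //; [exact: Citg_mul|exact: itgZ|].
  move=> y yL; rewrite Normc.normcM ler_pM ?normc_ge0//; first exact: FM.
  exact: normc_le_norm1.
rewrite mulrDl; apply: le_trans (normc_triangle _ _) _; rewrite normcN.
apply: lerD; rewrite Normc.normcM -[leRHS]mulrA; apply: ler_pM; rewrite ?normc_ge0 ?B1 ?B2//.
- exact: bd (CAC_continuous ds) M20 B2.
- exact: bd (CAC_continuous dc) M10 B1.
Qed.

Lemma solution_bound : exists2 K, 0 <= K & forall h U x, Citg h -> sol lam U h -> bdry a U ->
  x \in `[- L, L] -> normc (U x) <= K * prim (- L) (norm1 \o h) L.
Proof.
have dc := fund_dc fund; have ds := fund_ds fund.
have [M1 M10 B1] := continuous_normc_bounded (CAC_continuous dc).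
have [M2 M20 B2] := continuous_normc_bounded (CAC_continuous ds).
have [K K0 BK] := duhamel_bound.
pose Ks := K * normc (2 * s L)^-1.
pose Kc := (K + K + Ks * normc (s L - s p)) * normc (c L - c p)^-1.
have Ks0 : 0 <= Ks by rewrite mulr_ge0 ?normc_ge0.
have Kc0 : 0 <= Kc by rewrite mulr_ge0 ?normc_ge0// !addr_ge0// mulr_ge0 ?normc_ge0.
exists (K + (Kc * M1 + Ks * M2)) => [|h U x hi sU bU xL].
  by rewrite !addr_ge0// mulr_ge0.
rewrite (sol_bdry_unique hi sU bU)//.
pose N := prim (- L) (norm1 \o h) L.
have Bs : normc (coef_s h) <= Ks * N.
  rewrite /coef_s Normc.normcM normcN /Ks [leRHS]mulrAC ler_wpM2r ?normc_ge0//.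
  exact: BK.
have Bc : normc (coef_c h) <= Kc * N.
  rewrite /coef_c Normc.normcM /Kc [leRHS]mulrAC ler_wpM2r ?normc_ge0//.
  apply: le_trans (normc_triangle _ _) _; rewrite normcN Normc.normcM [leRHS]mulrDl.
  apply: lerD; last by rewrite [leRHS]mulrAC ler_wpM2r ?normc_ge0.
  apply: le_trans (normc_triangle _ _) _; rewrite normcN [leRHS]mulrDl.
  by apply: lerD; exact: BK.
rewrite -/N !mulrDl; apply: le_trans (normc_triangle _ _) _; apply: lerD; first exact: BK.
apply: le_trans (normc_triangle _ _) _; apply: lerD; rewrite Normc.normcM mulrAC;
by apply: ler_pM; rewrite ?normc_ge0// ?B1 ?B2.
Qed.

End Resolvent.

Section Spectrum.
Context {R : realType}.
Local Notation L := (pi / 2 : R).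
Local Notation leb := (@lebesgue_measure R).
Local Notation mu := (@muI R).
Local Notation II := ([set` `[(- L)%R, L]] : set R).
Local Notation Re := (@complex.Re R).
Local Notation Im := (@complex.Im R).
Local Notation C := (R[i]).
Local Notation normc := (@Normc.normc R).
Local Notation T := (measurableTypeR R).

Let r := fine (mu setT `^ 2^-1)%E.

Lemma mass_sqrt : (mu setT `^ 2^-1)%E = r%:E.
Proof. by rewrite /r fineK// fin_num_poweR// muI_fin. Qed.

Lemma measurable_normc (f : R -> C) : cL2 mu f -> measurable_fun (setT : set T) (normc \o f).
Proof.
move=> [/Lfun_measurable rf /Lfun_measurable mf].
rewrite (_ : normc \o f = Num.sqrt \o (fun x => Re (f x) ^+ 2 + Im (f x) ^+ 2)); last first.
  by apply/funext => x; exact: normcE_sqrt.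
apply: measurableT_comp.
  by apply: continuous_measurable_fun; exact: sqrt_continuous.
by apply: measurable_funD; apply: measurable_funX.
Qed.

Lemma prim_norm1_le h : cL2 mu h ->
  ((prim (- L) (norm1 \o h) L)%:E <= (2 * r)%:E * cL2norm mu h)%E.
Proof.
move=> h2; have [/Lfun_measurable rh /Lfun_measurable ih] := h2.
have mn := measurable_normc h2.
have m1 : measurable_fun (setT : set T) (norm1 \o h).
  by apply: measurable_funD; exact: measurableT_comp.
have n1i := itg_norm1 (cL2_Citg h2).
have -> : (prim (- L) (norm1 \o h) L)%:E = (\int[mu]_x (norm1 (h x))%:E)%E.
  rewrite integral_muI; last exact/measurable_EFinP.
  by rewrite /prim /Rintegral fineK//; exact: integrable_fin_num.
apply: (@le_trans _ _ (\int[mu]_x (2%:E * `|(normc (h x))%:E|))%E).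
  apply: ge0_le_integral => //.
  - by move=> x _; rewrite lee_fin addr_ge0.
  - exact/measurable_EFinP.
  - apply: measurable_funeM; apply: measurableT_comp => //.
    exact/measurable_EFinP.
  - move=> x _; rewrite /= -EFinM lee_fin ger0_norm ?normc_ge0//.
    exact: norm1_le_normc.
rewrite ge0_integralZl//; last first.
  by apply: measurableT_comp => //; exact/measurable_EFinP.
rewrite EFinM -muleA lee_wpmul2l//.
have := hoelder mu mn (measurable_cst (1 : R)) (ltr0n R 2) (ltr0n R 2).
rewrite Lnorm_cst1 mass_sqrt Lnorm1 [X in (_ <= X)%E]muleC.
have -> : (2^-1 + 2^-1 = 1 :> R) by lra.
move=> /(_ erefl); rewrite /cL2norm.
by under eq_integral do rewrite /= mulr1.
Qed.

Lemma cL2norm_le f (B : R) : 0 <= B -> cL2 mu f ->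
  (\forall x \ae leb, II x -> normc (f x) <= B) -> (cL2norm mu f <= (B * r)%:E)%E.
Proof.
move=> B0 f2 fB; have mn := measurable_normc f2.
rewrite /cL2norm unlock.
have mp : measurable_fun (setT : set T) (fun x => (`|normc (f x)| `^ 2)%:E).
  apply/measurable_EFinP; apply: (measurableT_comp (measurable_powR _)) => //.
  exact: measurableT_comp.
have H : (\int[mu]_x (`|(normc (f x))%:E| `^ 2) <= (B `^ 2)%:E * mu setT)%E.
  rewrite -(integral_cst mu measurableT).
  rewrite (integral_muI mp) integral_muI//.
  apply: ae_ge0_le_integral => //.
  - exact: measurable_funTS mp.
  - by move=> x _; rewrite lee_fin powR_ge0.
  - apply: (@filterS _ _ (ae_filter_ringOfSetsType leb) _ _ _ fB) => x fxB xL /=.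
    rewrite lee_fin ge0_ler_powR ?nnegrE//.
    by rewrite ger0_norm ?normc_ge0 ?fxB.
have -> : ((B * r)%:E = ((B `^ 2)%:E * mu setT) `^ 2^-1)%E.
  rewrite poweRM ?lee_fin ?powR_ge0// mass_sqrt poweR_EFin -powRrM mulfV ?pnatr_eq0//.
  by rewrite powRr1// EFinM.
apply: gt0_ler_poweR => //.
- by rewrite in_itv/= leey integral_ge0// => x _; rewrite poweR_ge0.
- by rewrite in_itv/= leey mule_ge0// lee_fin powR_ge0.
Qed.

Variables (a : R) (ha : -1 < a < 1) (lam : C) (c s : R -> C).
Hypothesis fund : fundamental lam c s.
Local Notation p := (L * a).

Lemma resolvent_setP : s L != 0 -> c L != c p -> resolvent_set mu (opH a) lam.
Proof.
move=> sL0 cLp.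
have [K K0 BK] := solution_bound ha fund sL0 cLp.
split.
- move=> f [g Afg [_ /ae_muI g0]]; apply/ae_muI.
  have C0 : Citg (fun=> 0 : C) by split; exact: itg_cst.
  have [U [sU fU bU]] := opH_sol ha Afg C0 ((ae_muI _ _).2 g0).
  apply: filterS fU => x /= fx xL; rewrite fx//.
  have := BK _ U x C0 sU bU xL.
  have -> : prim (- L) (norm1 \o fun=> 0) L = 0.
    rewrite /prim (@eq_Rintegral _ _ _ _ _ (fun=> 0)); first by rewrite Rintegral_cst// mul0r.
    by move=> y _; rewrite /norm1 /= normr0 addr0.
  rewrite mulr0 => Ux; apply: Normc.eq0_normc; apply/eqP.
  by rewrite eq_le Ux normc_ge0.
- move=> h h2.
  have hi := cL2_Citg h2.
  pose U x := duhamel c s h x + (coef_c a c s h * c x + coef_s c s h * s x).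
  have sU : sol lam U h.
    have := sol_comb 1 1 (sol_duhamel fund hi)
      (sol_comb (coef_c a c s h) (coef_s c s h) (sol_c fund) (sol_s fund)).
    case=> v uv vu; exists v; [apply: CAC_eq uv _ _|apply: CAC_eq vu _ _] => x _ //;
    by rewrite /U; ring.
  have [V UV VU] := sU.
  exists (patchI U), (fun x => lam * patchI U x + h x); split; last first.
    by apply/aeW => x _; ring.
  have U2 := CAC_cL2 UV.
  apply/(opHP _ _ ha); split=> //; first exact: cL2D (cL2Z _ U2) h2.
  exists U, V; have [b1 b2] := bdry_resolvent fund sL0 cLp h; split=> //.
  + by apply: CAC_eq VU _ _ => x xL //; rewrite patchIE.
  + exact: ae_patchI.
exists (K * r * (2 * r)) => f g Afg; have [f2 g2 _] := Afg.
pose h x := g x - lam * f x.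
have h2 : cL2 mu h.
  have := cL2D g2 (cL2Z (- lam) f2); congr (cL2 _ _); apply/funext => x.
  by rewrite mulNr.
have hi := cL2_Citg h2.
have [U [sU fU bU]] := opH_sol ha Afg hi (ae_eq_refl _ _ _).
pose N := prim (- L) (norm1 \o h) L.
have N0 : 0 <= N by apply: Rintegral_ge0 => x _; rewrite addr_ge0.
have r0 : 0 <= r by rewrite fine_ge0// poweR_ge0.
apply: (@le_trans _ _ (K * N * r)%:E).
  apply: cL2norm_le => //; first exact: mulr_ge0.
  by apply: filterS fU => x /= fx xL; rewrite fx//; exact: BK.
rewrite mulrAC EFinM [X in (_ <= X * _)%E]EFinM -[leRHS]muleA lee_wpmul2l ?lee_fin ?mulr_ge0//.
exact: prim_norm1_le.
Qed.

End Spectrum.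

Section Classification.
Context {R : realType}.
Local Notation L := (pi / 2 : R).
Local Notation mu := (@muI R).
Local Notation C := (R[i]).
Variables (a : R) (ha : -1 < a < 1).
Local Notation p := (L * a).
Local Notation tp := (pi * (1 + a) / 4 : R).
Local Notation tm := (pi * (1 - a) / 4 : R).

Lemma sigma_pm_zero (sg : R) (lam : C) (c s : R -> C) : fundamental lam c s ->
  0 < 1 + sg * a -> sigma_pm sg a lam <-> lam != 0 /\ s (pi * (1 + sg * a) / 4) = 0.
Proof.
move=> fund a0; have pi0 := lt0r_neq0 (pi_gt0 R); have a0' := lt0r_neq0 a0.
have t0 : 0 < pi * (1 + sg * a) / 4 by rewrite divr_gt0// mulr_gt0 ?pi_gt0.
have E (m : nat) : pi * m%:R / (pi * (1 + sg * a) / 4) = 4 * m%:R / (1 + sg * a).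
  by move: (pi : R) pi0 => q q0; field; rewrite q0 a0'.
split=> [[m m0 lamE]|[lam0 /(fund_zero fund t0 lam0)[m m0 lamE]]]; last first.
  by exists m => //; rewrite lamE E.
have lam0 : lam != 0.
  rewrite lamE realC_eq0 expf_neq0// !mulf_neq0 ?invr_eq0 ?pnatr_eq0 -?lt0n//.
split=> //; apply/(fund_zero fund t0 lam0); exists m => //.
by rewrite lamE E.
Qed.

Lemma sigma_both_zero (lam : C) (c s : R -> C) : fundamental lam c s ->
  (sigma_pm (-1) a `&` sigma_pm 1 a) lam <-> [/\ lam != 0, s tp = 0 & s tm = 0].
Proof.
move=> fund; have /andP[a1 a2] := ha.
have E1 := @sigma_pm_zero 1 lam c s fund; have E2 := @sigma_pm_zero (-1) lam c s fund.
rewrite mul1r in E1; rewrite mulN1r in E2.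
split=> [[/E2 H2 /E1 H1]|[lam0 sp sm]].
  by have [|lam0 st] := H1; first lra; have [|_ st'] := H2; first lra.
by split; [apply/E2|apply/E1]; rewrite ?lam0//; lra.
Qed.

Lemma fund_half_angles (lam : C) (c s : R -> C) : fundamental lam c s ->
  [/\ s L = s tp * c tm + c tp * s tm, s p = s tp * c tm - c tp * s tm
    & c L - c p = - (2 * lam) * (s tp * s tm)].
Proof.
move=> fund; have EL : L = tp + tm by field.
have Ep : p = tp - tm by field.
rewrite EL (_ : (tp + tm) * a = tp - tm); last by field.
rewrite !(fund_sD fund) !(fund_cD fund) (fund_sN fund) (fund_cN fund).
by split; ring.
Qed.

Lemma not_both_cases (lam : C) : ~ (sigma_pm (-1) a `&` sigma_pm 1 a) lam ->
  resolvent_set mu (opH a) lam \/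
  (op_eigenvalue mu (opH a) lam /\ algebraic_multiplicity mu (opH a) lam 1).
Proof.
have [c [s fund]] := fundamental_exists lam.
have [sLE spE cLpE] := fund_half_angles fund.
have /andP[a1 a2] := ha; have L0 := @halfpi_gt0 R.
have Lp0 : L + p != 0.
  apply/lt0r_neq0; rewrite (_ : _ + _ = L * (1 + a)); last by ring.
  by apply: mulr_gt0 => //; lra.
have Lm0 : L - p != 0.
  apply/lt0r_neq0; rewrite (_ : _ - _ = L * (1 - a)); last by ring.
  by apply: mulr_gt0 => //; lra.
move=> /(contra_not (iffRL (sigma_both_zero fund))) nboth.
have [lam0|lam0] := eqVneq lam 0.
  right; have sE := fund_lam0 fund lam0; apply: (multiplicity_even ha fund).
  - by rewrite sE realC_eq0 lt0r_neq0.
  - by apply/eqP; rewrite -subr_eq0 cLpE lam0 mulr0 oppr0 mul0r.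
  - rewrite !sE -!rmorphM (inj_eq (@complexI R)) -subr_eq0.
    by rewrite (_ : _ - _ = (L + p) * (L - p)) ?mulf_neq0//; ring.
have even (sg : R) : c L = c p -> s L != 0 -> s p = sg%:C * s L -> L - sg * p != 0 ->
    op_eigenvalue mu (opH a) lam /\ algebraic_multiplicity mu (opH a) lam 1.
  move=> cLp sL0 sE n0; apply: (multiplicity_even ha fund) => //.
  rewrite sE mulrA -rmorphM -subr_eq0 -mulrBl -rmorphB mulf_neq0// realC_eq0.
  by rewrite (mulrC _ sg).
have [sp0|sp0] := eqVneq (s tp) 0; have [sm0|sm0] := eqVneq (s tm) 0.
- by case: nboth.
- right; apply: (even (-1)).
  + by apply/eqP; rewrite -subr_eq0 cLpE sp0 mul0r mulr0.
  + by rewrite sLE sp0 mul0r add0r mulf_neq0// (fund_c_neq0 fund).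
  + by rewrite spE sLE sp0 mul0r !add0r rmorphN1 mulN1r.
  + by rewrite mulN1r opprK.
- right; apply: (even 1).
  + by apply/eqP; rewrite -subr_eq0 cLpE sm0 !mulr0.
  + by rewrite sLE sm0 mulr0 addr0 mulf_neq0// (fund_c_neq0 fund).
  + by rewrite spE sLE sm0 mulr0 subr0 addr0 rmorph1 mul1r.
  + by rewrite mul1r.
have cLp : c L != c p.
  by rewrite -subr_eq0 cLpE mulf_neq0 ?oppr_eq0 ?mulf_neq0// pnatr_eq0.
have [sL0|sL0] := eqVneq (s L) 0; [right|left].
  exact: (multiplicity_odd ha fund).
exact: (resolvent_setP ha fund).
Qed.

Lemma both_multiplicity (lam : C) : (sigma_pm (-1) a `&` sigma_pm 1 a) lam ->
  [/\ op_eigenvalue mu (opH a) lam, geometric_multiplicity mu (opH a) lam 2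
    & algebraic_multiplicity mu (opH a) lam 3].
Proof.
have [c [s fund]] := fundamental_exists lam.
move=> /(sigma_both_zero fund)[lam0 sp0 sm0].
have [sLE spE cLpE] := fund_half_angles fund.
apply: (triple_multiplicity ha fund) => //.
- by rewrite sLE sp0 sm0 mul0r mulr0 addr0.
- by rewrite spE sp0 sm0 mul0r mulr0 subr0.
- by apply/eqP; rewrite -subr_eq0 cLpE sp0 mul0r mulr0.
Qed.

Lemma resolvent_not_eigenvalue (lam : C) : resolvent_set mu (opH a) lam ->
  ~ op_eigenvalue mu (opH a) lam.
Proof. by move=> [ker0 _ _] [f /ker0]. Qed.

Lemma both_ratio (lam : C) : (sigma_pm (-1) a `&` sigma_pm 1 a) lam ->
  exists m n : nat, [/\ (0 < m + n)%N, a * (m + n)%:R = n%:R - m%:R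
    & lam = ((2 * (m + n)%:R : R) ^+ 2)%:C].
Proof.
have /andP[a1 a2] := ha.
have p1 : 0 < 1 + 1 * a by lra.
have p2 : 0 < 1 + - 1 * a by lra.
move=> [[m m0 lamE] [n n0]]; rewrite lamE => /complexI/eqP.
rewrite eqf_sqr => /orP[|/eqP E]; last first.
  have : 0 < 4 * m%:R / (1 + -1 * a) by rewrite divr_gt0// mulr_gt0// ltr0n.
  have n_ge0 : 0 <= 4 * n%:R / (1 + 1 * a) by apply: divr_ge0; [exact: mulr_ge0|exact: ltW].
  by rewrite E oppr_gt0 ltNge n_ge0.
rewrite eqr_div ?lt0r_neq0// => /eqP E.
have aE : a * (m + n)%:R = n%:R - m%:R by rewrite natrD; lra.
exists m, n; split=> //; first by rewrite addn_gt0 m0.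
congr (_ ^+ 2)%:C.
apply: (mulIf (lt0r_neq0 p2)); rewrite divfK ?lt0r_neq0//.
rewrite natrD in aE *; lra.
Qed.

End Classification.

Theorem proposition4 (R : realType) (a : R) (ha : -1 < a < 1) :
  (~ rational a ->
     forall lam : R[i], op_eigenvalue muI (opH a) lam ->
       algebraic_multiplicity muI (opH a) lam 1) /\
  (rational a ->
     [/\ forall lam : R[i],
           (spectrum muI (opH a) `\` (sigma_pm (-1) a `&` sigma_pm 1 a)) lam ->
           op_eigenvalue muI (opH a) lam /\
           algebraic_multiplicity muI (opH a) lam 1,
         sigma_pm (-1) a `&` sigma_pm 1 a =
           sigma_pm (-1) a `&` sigma_pm 1 a `&` sigma0
       & forall lam : R[i],
           (sigma_pm (-1) a `&` sigma_pm 1 a) lam ->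
           [/\ op_eigenvalue muI (opH a) lam,
               geometric_multiplicity muI (opH a) lam 2
             & algebraic_multiplicity muI (opH a) lam 3]]).
Proof.
split=> [irr lam elam|_].
  have nboth : ~ (sigma_pm (-1) a `&` sigma_pm 1 a) lam.
    move=> /(both_ratio ha)[m [n [mn0 aE _]]]; apply: irr.
    exists ((n%:R - m%:R) / (m + n)%:R) => //.
    rewrite fmorph_div rmorphB !rmorph_nat -aE mulfK//.
    by rewrite pnatr_eq0 -lt0n.
  by case: (not_both_cases ha nboth) => [/resolvent_not_eigenvalue|[]].
split.
- by move=> lam [slam /(not_both_cases ha)[|]].
- apply/seteqP; split=> lam; last by case.
  move=> H; split=> //; have [m [n [_ _ ->]]] := both_ratio ha H.
  by exists (m + n)%N.
- exact: both_multiplicity.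
Qed.
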